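(* Let $x\in\mathbb{R}^d$ and $t>0$. Suppose there exist a constant $\delta>0$ and positive constants $D,C_H,C_1,C_2,C_3,a_{\mathcal{G}}$ such that the following hold. (a) For any $s>0$, $y\in\mathbb{R}^d$ and $r>0$, $P^0(X^{(n)}_s\in H(y,r))\to\int_{H(y,r)}k^{(D)}_s(y')\,dy'$ as $n\to\infty$. (b) $p_k(0,y)\le C_2k^{-d/2}$ for all $y\in\mathcal{G}$ and $k\ge C_3$. (c) For each $y\in\mathcal{G}$ there exists $s(y)<\infty$ such that the parabolic Harnack inequality holds with constant $C_H$ for $Q(y,R,R^2)$ for all $R\ge s(y)$. (d) For any $r>0$, $\mu(\Lambda_n(x,r))/(2n^{1/2}r)^d\to a_{\mathcal{G}}$ as $n\to\infty$. (e) For each $r>0$ there exists $n_0$ such that, for $n\ge n_0$, $|x'-y'|_\infty\le d_{\mathcal{G}}(x',y')\le(C_1|x'-y'|_\infty)\vee n^{1/2-\delta}$ for all $x',y'\in\Lambda_n(x,r)$. (f) $n^{-1/2}s(g_n(x))\to0$ as $n\to\infty$. Then $$\lim_{n\to\infty}n^{d/2}\,\hat p_{nt}(0,g_n(x))=2a_{\mathcal{G}}^{-1}k^{(D)}_t(x).$$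
   Context: Setting. $d\ge2$; $\mathcal{G}$ is an infinite connected subgraph of the nearest-neighbour lattice $\mathbb{Z}^d$ (its vertex set is also denoted $\mathcal{G}$) with $0\in\mathcal{G}$; $d_{\mathcal{G}}$ is the graph distance in $\mathcal{G}$ and $B(x,r)=\{y\in\mathcal{G}:d_{\mathcal{G}}(x,y)<r\}$; $x\sim y$ means $\{x,y\}$ is an edge of $\mathcal{G}$. For $A\subset\mathcal{G}$, $\overline A$ is the union of $A$ and the set of vertices of $\mathcal{G}\setminus A$ having a neighbour in $A$. Conductances $\mu_{xy}=\mu_{yx}$ on $\mathcal{G}\times\mathcal{G}$ satisfy $\mu_{xy}=0$ if $x\neq y$ and $x\not\sim y$, $0<C_M^{-1}\le\mu_{xy}\le C_M$ if $x\sim y$, $0\le\mu_{xx}\le C_M$ for all $x$; $\mu_x=\sum_y\mu_{xy}$, $\mu(A)=\sum_{x\in A}\mu_x$, and $\mu(B(x,r))\le C_Ur^d$ for $r\ge1$, $x\in\mathcal{G}$, where $C_M,C_U$ are constants. $X=(X_n,n\in\mathbb{Z}_+,P^x,x\in\mathcal{G})$ is the Markov chain with transition probabilities $\mu_{xy}/\mu_x$, $p_n(x,y)=P^x(X_n=y)/\mu_y$, and for real $t\ge0$, $\hat p_t(x,y)=p_{\lfloor t\rfloor}(x,y)+p_{\lfloor t\rfloor+1}(x,y)$. Notation. $k^{(D)}_t(x)=(2\pi tD)^{-d/2}e^{-|x|^2/(2Dt)}$; $X^{(n)}_t=n^{-1/2}X_{\lfloor nt\rfloor}$; $H(x,r)=x+[-r,r]^d$,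 $\Lambda(x,r)=H(x,r)\cap\mathcal{G}$, $\Lambda_n(x,r)=\Lambda(xn^{1/2},rn^{1/2})$; $g_n(x)$ is a closest point of $\mathcal{G}$ to $n^{1/2}x$ in the $|\cdot|_\infty$ norm (ties broken by a fixed ordering of $\mathbb{Z}^d$); $s\vee t=\max(s,t)$. Parabolic Harnack inequality (PHI). Let $\mathcal{L}f(x)=\mu_x^{-1}\sum_y\mu_{xy}(f(y)-f(x))$, $Q=Q(x,R,T)=(0,T]\times B(x,R)$, $Q_-=[\frac14T,\frac12T]\times B(x,\frac12R)$, $Q_+=[\frac34T,T]\times B(x,\frac12R)$. $u$ is caloric on $Q$ if it is defined on $([0,T]\cap\mathbb{Z})\times\overline{B(x,R)}$ and $u(n+1,y)-u(n,y)=\mathcal{L}u(n,y)$ for integers $0\le n\le T-1$, $y\in B(x,R)$. The PHI holds with constant $C_H$ for $Q$ if for all non-negative $u$ caloric on $Q$, with $\hat u(n,y)=u(n+1,y)+u(n,y)$, $\sup_{Q_-}\hat u\le C_H\inf_{Q_+}\hat u$ (over integers $n$ with $n+1\le T$). *)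

(* Defs.v *)
From HB Require Import structures.
From mathcomp Require Import all_boot all_order all_algebra.
From mathcomp Require Import all_classical all_reals all_analysis.
Set Implicit Arguments.
Unset Strict Implicit.
Unset Printing Implicit Defensive.
Import Order.TTheory GRing.Theory Num.Theory.
Import numFieldNormedType.Exports.
Local Open Scope classical_set_scope.
Local Open Scope ring_scope.

Definition tuple_cons T n (z : T * n.-tuple T) : n.+1.-tuple T :=
  [the n.+1.-tuple T of z.1 :: z.2].

Lemma measurable_tuple_cons dT (T : measurableType dT) n :
  measurable_fun setT (@tuple_cons T n).
Proof.
by apply: measurable_cons; [exact: measurable_fst|exact: measurable_snd].
Qed.

Section lebesgue_step.
Context (R : realType) (n : nat).
Local Notation M := (measurableTypeR R).
Variable mu : {sigma_finite_measure set (n.-tuple M) -> \bar R}.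

Definition lebesgue_step : set (n.+1.-tuple M) -> \bar R :=
  pushforward ((@lebesgue_measure R) \x mu)%E (@tuple_cons M n).

Let step_measure : {measure set (n.+1.-tuple M) -> \bar R} :=
  @measure_function_pushforward__canonical__measure_function_Measure _ _ _ _ R
    [the measure _ _ of ((@lebesgue_measure R) \x mu)%E] _
    (@measurable_tuple_cons _ M n).

HB.instance Definition _ := isMeasure.Build _ _ _ lebesgue_step
  (@measure0 _ _ _ step_measure) (@measure_ge0 _ _ _ step_measure)
  (@measure_semi_sigma_additive _ _ _ step_measure).

Lemma lebesgue_step_sigma_finite : sigma_finite setT lebesgue_step.
Proof.
have /sigma_finiteP[F [TF ndF Foo]] := sigma_finiteT (@lebesgue_measure R).
have /sigma_finiteP[G [TG ndG Goo]] := sigma_finiteT mu.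
pose uncons (v : n.+1.-tuple M) : (M * n.-tuple M)%type :=
  (thead v, [tuple of behead v]).
have muncons : measurable_fun setT uncons.
  by apply/measurable_fun_pairP; split;
    [exact: measurable_tnth|exact: measurable_behead].
have consK : cancel (@tuple_cons M n) uncons.
  by move=> [a v]; congr pair; exact/val_inj.
exists (fun i => uncons @^-1` (F i `*` G i)).
  apply/esym/seteqP; split=> // v _.
  have [i _ Fi] : (\bigcup_i F i) (uncons v).1 by rewrite -TF.
  have [j _ Gj] : (\bigcup_i G i) (uncons v).2 by rewrite -TG.
  exists (maxn i j) => //; split.
    by move: Fi; exact/subsetPset/ndF/leq_maxl.
  by move: Gj; exact/subsetPset/ndG/leq_maxr.
move=> i; have [mF Fi] := Foo i; have [mG Gi] := Goo i; split.
  rewrite -[X in measurable X]setTI; apply: muncons => //.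
  exact: measurableX.
rewrite /lebesgue_step /pushforward -comp_preimage.
rewrite (_ : uncons \o _ = id); last by apply/funext => z; exact: consK.
by rewrite preimage_id product_measure1E// lte_mul_pinfty// ge0_fin_numE.
Qed.

HB.instance Definition _ :=
  Measure_isSigmaFinite.Build _ _ _ lebesgue_step lebesgue_step_sigma_finite.

End lebesgue_step.

(* n-fold product of the Lebesgue measure of the line; lebesgue_tuple_box gives
   its value on boxes. *)
Fixpoint lebesgue_tuple (R : realType) n :
    {sigma_finite_measure set (n.-tuple (measurableTypeR R)) -> \bar R} :=
  match n with
  | 0 => [the {sigma_finite_measure set _ -> \bar R} of
           \d_([tuple] : 0.-tuple (measurableTypeR R))]
  | k.+1 => [the {sigma_finite_measure set _ -> \bar R} of
           lebesgue_step (lebesgue_tuple R k)]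
  end.

Lemma lebesgue_tuple_box (R : realType) n (A : 'I_n -> set (measurableTypeR R)) :
  (forall i, measurable (A i)) ->
  lebesgue_tuple R n [set v | forall i, A i (tnth v i)] =
  (\prod_(i < n) lebesgue_measure (A i))%E.
Proof.
elim: n A => [|n IH] A mA.
  rewrite big_ord0 /= diracE mem_set//= => -[] //.
rewrite big_ord_recl /= -IH//.
rewrite -product_measure1E//; last first.
  rewrite (_ : [set v | _] = \bigcap_(i in [set: 'I_n])
      ((@tnth _ (measurableTypeR R))^~ i @^-1` A (lift ord0 i))).
    apply: fin_bigcap_measurable; first exact: finite_finset. move=> i _.
    by rewrite -[X in measurable X]setTI; apply: (measurable_tnth i).
  by apply/seteqP; split=> v /= H i; [move=> _|]; exact: H.
congr (product_measure1 _ _ _); apply/seteqP; split=> -[a v] /=.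
  move=> H; split; first exact: (H ord0).
  by move=> i; have := H (lift ord0 i); rewrite /= tnthS.
move=> [Ha Hv] i; case: (unliftP ord0 i) => [j|] ->; rewrite ?tnthS //.
Qed.

(* Points of R^d and Z^d are row vectors; `|v| on row vectors is the
   sup norm. *)
Section geometry.
Context {R : realType} {d : nat}.
Implicit Types (x y : 'rV[R]_d) (z : 'rV[int]_d).

Definition to_real z : 'rV[R]_d := map_mx intr z.

Definition enorm x : R := Num.sqrt (\sum_(i < d) x 0 i ^+ 2).

Definition box x (r : R) : set 'rV[R]_d :=
  [set y | forall i, x 0 i - r <= y 0 i <= x 0 i + r].

Definition gauss_kernel (D t : R) x : R :=
  (2 * pi * t * D) `^ (- (d%:R / 2)) * expR (- (enorm x ^+ 2 / (2 * D * t))).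

Definition lebesgue_integral_Rd (A : set 'rV[R]_d) (f : 'rV[R]_d -> R) : \bar R :=
  let pt (v : d.-tuple (measurableTypeR R)) : 'rV[R]_d := \row_i tnth v i in
  (\int[lebesgue_tuple R d]_(v in pt @^-1` A) (f (pt v))%:E)%E.

End geometry.

(* Not necessarily induced: an edge of Z^d between two vertices may be absent. *)
Record lattice_subgraph (d : nat) := LatticeSubgraph {
  vertex : set 'rV[int]_d ;
  edge : rel 'rV[int]_d ;
  edge_sym : forall x y, edge x y -> edge y x ;
  edge_vertex : forall x y, edge x y -> vertex x /\ vertex y ;
  edge_nearest : forall x y, edge x y -> \sum_(i < d) `|x 0 i - y 0 i| = 1 }.

Section graph.
Context {R : realType} {d : nat} (G : lattice_subgraph d).
Local Notation V := 'rV[int]_d.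
Implicit Types (x y z : V) (A : set V) (r : R).

Definition walk x y (n : nat) : Prop :=
  exists p : seq V, [/\ path (edge G) x p, last x p = y & size p = n].

Definition connected_graph : Prop :=
  forall x y, vertex G x -> vertex G y -> exists n, walk x y n.

(* The default value 0 is only returned when there is no walk from x to y. *)
Definition gdist x y : nat :=
  xget 0%N [set n | walk x y n /\ forall m, walk x y m -> (n <= m)%N].

Definition gball x r : set V := [set y | vertex G y /\ (gdist x y)%:R < r].

Definition gclosure A : set V :=
  A `|` [set y | [/\ vertex G y, ~ A y & exists2 x, A x & edge G x y]].

Definition box_vertices (x : 'rV[R]_d) r : set V :=
  [set z | vertex G z /\ box x r (to_real z)].

Definition scaled_box_vertices (n : nat) (x : 'rV[R]_d) r : set V :=
  box_vertices (Num.sqrt n%:R *: x) (r * Num.sqrt n%:R).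

Definition closest_vertex (n : nat) (x : 'rV[R]_d) z : Prop :=
  vertex G z /\ forall w, vertex G w ->
    `|to_real z - Num.sqrt n%:R *: x| <= `|to_real w - Num.sqrt n%:R *: x|.

(* Closest vertices are finitely many and exist, so the default is not used
   when tie is a total order. *)
Definition gpoint (tie : rel V) (n : nat) (x : 'rV[R]_d) : V :=
  xget 0 [set z | closest_vertex n x z /\
                  forall w, closest_vertex n x w -> tie z w].

End graph.

Section walk_on_graph.
Context {R : realType} {d : nat} (G : lattice_subgraph d).
Local Notation V := 'rV[int]_d.
Variable mu : V -> V -> R.
Implicit Types (x y z : V) (A : set V).

(* The values of mu outside of the vertex set of G play no role. *)
Record conductances (CM : R) : Prop := Conductances {
  bound_gt0 : 0 < CM ;
  cond_sym : forall x y, vertex G x -> vertex G y -> mu x y = mu y x ;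
  cond_nonedge : forall x y, vertex G x -> vertex G y ->
    x != y -> ~~ edge G x y -> mu x y = 0 ;
  cond_edge : forall x y, edge G x y -> CM^-1 <= mu x y <= CM ;
  cond_loop : forall x, vertex G x -> 0 <= mu x x <= CM }.

(* Finitely many nonzero terms: x has at most 2d neighbours. *)
Definition cond_vertex x : R := \sum_(y \in vertex G) mu x y.

(* Only used for finite sets A; the sum would be 0 by convention otherwise. *)
Definition cond_measure A : R := \sum_(x \in A) cond_vertex x.

Definition volume_bound (CU : R) : Prop :=
  forall x (r : R), vertex G x -> 1 <= r ->
    cond_measure (gball G x r) <= CU * r ^+ d.

Section chain.
Context {disp : measure_display} {Omega : measurableType disp}.
Variables (P : V -> probability Omega R) (X : nat -> Omega -> V).

(* The last field is the Markov property
   P^x(X_{n+1} = h_{n+1} | X_0 = h_0, ..., X_n = h_n) = mu_{h_n h_{n+1}}/mu_{h_n}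
   multiplied by the probability of the conditioning event. *)
Record markov_chain : Prop := MarkovChain {
  chain_vertex : forall n w, vertex G (X n w) ;
  chain_measurable : forall n y, measurable (X n @^-1` [set y]) ;
  chain_start : forall x, vertex G x -> P x [set w | X 0 w = x] = 1%E ;
  chain_step : forall x n (h : nat -> V),
    vertex G x -> (forall i, vertex G (h i)) ->
    P x [set w | forall i, (i <= n.+1)%N -> X i w = h i] =
    (P x [set w | forall i, (i <= n)%N -> X i w = h i] *
     (mu (h n) (h n.+1) / cond_vertex (h n))%:E)%E }.

Definition rescaled_chain (n : nat) (t : R) (w : Omega) : 'rV[R]_d :=
  (Num.sqrt n%:R)^-1 *: to_real (X (Num.truncn (n%:R * t)) w).

Definition heat_kernel (n : nat) x y : R :=
  fine (P x [set w | X n w = y]) / cond_vertex y.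

Definition heat_kernel_hat (t : R) x y : R :=
  heat_kernel (Num.truncn t) x y + heat_kernel (Num.truncn t).+1 x y.

End chain.

Definition generator (f : V -> R) x : R :=
  (cond_vertex x)^-1 * \sum_(y \in vertex G) mu x y * (f y - f x).

(* A function on ([0,T] /\ Z) x closure (B(x,r)) is given by a total function u,
   of which only the values on this set are used. *)
Definition caloric x (r T : R) (u : nat -> V -> R) : Prop :=
  forall n y, n%:R <= T - 1 -> gball G x r y ->
    u n.+1 y - u n y = generator (u n) y.

Definition hat_values (u : nat -> V -> R) x (r T a b : R) : set (\bar R) :=
  [set v | exists n y, [/\ a <= n%:R <= b, n.+1%:R <= T, gball G x r y
                         & v = (u n.+1 y + u n y)%:E]].

Definition PHI (CH : R) x (r T : R) : Prop :=
  forall u : nat -> V -> R,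
    (forall n y, n%:R <= T -> gclosure G (gball G x r) y -> 0 <= u n y) ->
    caloric x r T u ->
    (ereal_sup (hat_values u x (r / 2) T (T / 4) (T / 2)) <=
     CH%:E * ereal_inf (hat_values u x (r / 2) T (3 / 4 * T) T))%E.

End walk_on_graph.

(* Main.v *)
(* The caloric function [p_n(0, .)] is shown to oscillate by at most [eps n^(-d/2)]
   near time [nt] on a box of side of order [n^(1/2)] around [g_n(x)]. Its sum
   over this box is a probability, which converges by the central limit
   theorem, and the volume of the box converges as well, so their quotient
   gives the limit of [p^_{nt}(0, g_n(x))].

   In discrete time Harnack's inequality bounds only [u(n+1, .) + u(n, .)], and
   [u] need not be of constant sign when this sum is. So each step of the usual
   oscillation argument costs an average over two consecutive times, and after
   [K] steps it is a binomial average of [p_n] that oscillates little. To go back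
   to the average over two times, [p_{n+2} - p_n = O(n^(-1-d/2))] is needed:
   [|p_{a+2}(0, .) - p_a(0, .)|^2] is the second difference of the sequence
   [p_{2a}(0, 0)], which is monotone up to order three and [O(a^(-d/2))], while
   [p_{2m}(z, z) = O(m^(-d/2))] for [z] near [g_n(x)] by Harnack's inequality and
   the volume bound; their inner product is then at most half of
   [lam |f|^2 + |g|^2 / lam] with [lam = n]. *)
Require Import Defs.
From mathcomp Require Import all_boot all_order all_algebra.
From mathcomp Require Import all_classical all_reals all_analysis.
From mathcomp Require Import finmap measurable_realfun zify ring lra.
Set Implicit Arguments.
Unset Strict Implicit.
Unset Printing Implicit Defensive.
Import Order.TTheory GRing.Theory Num.Theory.
Import numFieldNormedType.Exports.
Local Open Scope classical_set_scope.
Local Open Scope ring_scope.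

(** * Sums with finitely many nonzero terms, and finiteness of lattice boxes *)

Lemma fsum_seq (R : realType) (T : choiceType) (A : set T) (r : seq T)
    (f : T -> R) :
  uniq r -> (forall i, i \in r -> A i) ->
  (forall i, A i -> i \notin r -> f i = 0) ->
  \sum_(i \in A) f i = \sum_(i <- r) f i.
Proof.
move=> ur rA f0; rewrite [RHS]fsbig_seq//; apply/esym/fsbig_widen => //.
by move=> i [Ai /negP]; exact: f0.
Qed.

Lemma finite_int_box (d : nat) (x : 'rV[int]_d) (m : nat) :
  finite_set [set z : 'rV[int]_d | forall i, `|z 0 i - x 0 i| <= m%:Z].
Proof.
pose f (g : {ffun 'I_d -> 'I_(m + m).+1}) : 'rV[int]_d :=
  \row_i (x 0 i - m%:Z + (g i)%:Z).
apply: (@sub_finite_set _ _ (range f)); last exact: finite_image.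
move=> z /= zx.
have lb i : 0 <= z 0 i - x 0 i + m%:Z.
  by have := zx i; rewrite ler_norml => /andP[+ _]; lia.
exists [ffun i => inord (absz (z 0 i - x 0 i + m%:Z))] => //.
apply/rowP => i; rewrite !mxE ffunE inordK; last first.
  have := zx i; have := lb i; rewrite ler_norml => + /andP[+ +]; lia.
by rewrite gez0_abs// addrCA addrA; lia.
Qed.

(** * Graph distance, balls and neighbours *)

Section graph_distance.
Context {R : realType} {d : nat} (G : lattice_subgraph d).
Local Notation V := 'rV[int]_d.
Implicit Types (x y z : V) (A : set V) (r : R).

(** The existence of a walk excludes the default value of [gdist], since the set of lengths of walks
    then has a least element. *)
Lemma gdistP x y : (exists n, walk G x y n) ->
  walk G x y (gdist G x y) /\ forall m, walk G x y m -> (gdist G x y <= m)%N.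
Proof.
move=> xy; have xyb : exists n, `[< walk G x y n >].
  by have [n ?] := xy; exists n; apply/asboolP.
rewrite /gdist; case: xgetP => [n -> [] //|nope].
exfalso; have [n /asboolP wn nmin] := ex_minnP xyb.
apply: (nope n); split => // m wm; apply: nmin; exact/asboolP.
Qed.

Lemma gdistxx x : gdist G x x = 0%N.
Proof.
have wx : walk G x x 0 by exists [::].
by have [_ /(_ _ wx)] := gdistP (ex_intro _ 0%N wx); rewrite leqn0 => /eqP.
Qed.

Lemma gdist_edge x y z : (exists n, walk G x y n) -> edge G y z ->
  (gdist G x z <= (gdist G x y).+1)%N.
Proof.
move=> /gdistP[[p [pp lp sp]] _] yz.
have wz : walk G x z (gdist G x y).+1.
  exists (rcons p z); split; first by rewrite rcons_path pp lp.
    by rewrite last_rcons.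
  by rewrite size_rcons sp.
by have [_] := gdistP (ex_intro _ _ wz); exact.
Qed.

(** Adding neighbours increases the distance by at most one, and [r + 1 <= 2 * r]. Bounds on the
    ball of radius [2 * r] thus yield the sign condition of [PHI], which is imposed on the closure
    of the ball of radius [r]. *)
Lemma gclosure_gball x r : connected_graph G -> vertex G x -> 1 <= r ->
  gclosure G (gball G x r) `<=` gball G x (2 * r).
Proof.
move=> Gc Vx r1 z [[Vz zr]|[Vz _ [y [Vy yr] yz]]].
  by split=> //; apply: lt_le_trans zr _; lra.
split=> //; have := gdist_edge (Gc _ _ Vx Vy) yz.
by rewrite -(ler_nat R) -natr1 => /le_lt_trans; apply; lra.
Qed.

Lemma finite_neighbours x : finite_set [set y | edge G x y].
Proof.
apply: (sub_finite_set _ (finite_int_box x 1)) => y /= /(@edge_nearest _ G) xy i.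
suff : `|y 0 i - x 0 i| <= \sum_(i < d) `|x 0 i - y 0 i| by rewrite xy.
by rewrite distrC (bigD1 i)//= lerDl sumr_ge0.
Qed.

Lemma finite_box_vertices (x : 'rV[R]_d) r : finite_set (box_vertices G x r).
Proof.
have [m mx] : exists m : nat, forall i, `|x 0 i| + r <= m%:R.
  exists (Num.truncn (\sum_i `|x 0 i| + `|r|)).+1 => i.
  rewrite (le_trans _ (ltW (truncnS_gt _)))// lerD ?ler_norm//.
  by rewrite (bigD1 i)//= lerDl sumr_ge0.
apply: (sub_finite_set _ (finite_int_box 0 m)) => z /= [_ xz] i.
have := mx i; have := xz i; rewrite !mxE subr0 => /andP[lz uz] xm.
rewrite -(ler_int R) intr_norm -pmulrn ler_norml.
have := ler_norm (x 0 i); have := ler_norm (- x 0 i); rewrite normrN.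
by move=> ? ?; apply/andP; split; lra.
Qed.

(** There is a vertex other than [x], and a walk to it starts with an edge. This makes [cond_vertex]
    positive, as the loop alone may have conductance zero. *)
Lemma infinite_connected_edge x : infinite_set (vertex G) ->
  connected_graph G -> vertex G x -> exists y, edge G x y.
Proof.
move=> Ginf Gc Vx; have [y [Vy yx]] : exists y, vertex G y /\ y != x.
  apply: contrapT => nope; apply: Ginf; apply: (sub_finite_set _ (finite_set1 x)).
  by move=> y Vy /=; apply: contrapT => /eqP yx; apply: nope; exists y.
have [n [[|z p] [/= pp lp _]]] := Gc _ _ Vx Vy; first by rewrite lp eqxx in yx.
by exists z; case/andP: pp.
Qed.

End graph_distance.

(** * The Markov operator: symmetry and contraction for the weights [cond_vertex] *)

Section reversible_operator.
Context {R : realType} {d : nat} (G : lattice_subgraph d).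
Local Notation V := 'rV[int]_d.
Variables (mu : V -> V -> R) (CM : R).
Hypothesis G_infinite : infinite_set (vertex G).
Hypothesis G_connected : connected_graph G.
Hypothesis mu_cond : conductances G mu CM.
Implicit Types (x y z w : V) (f g : V -> R).
Local Notation m := (cond_vertex G mu).

Lemma cond_ge0 z w : vertex G z -> vertex G w -> 0 <= mu z w.
Proof.
move=> Vz Vw; have [zw|zw] := boolP (edge G z w).
  have /andP[+ _] := cond_edge mu_cond zw; apply: le_trans.
  by rewrite invr_ge0 ltW// (bound_gt0 mu_cond).
have [<-|nzw] := eqVneq z w; first by have /andP[] := cond_loop mu_cond Vz.
by rewrite (cond_nonedge mu_cond Vz Vw nzw zw).
Qed.

Lemma cond_support z : vertex G z -> exists r : seq V, [/\ uniq r,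
  forall w, w \in r -> vertex G w &
  forall w, vertex G w -> w \notin r -> mu z w = 0].
Proof.
move=> Vz; pose A := [set w | edge G z w].
have finA : finite_set A by exact: finite_neighbours.
have zV w : (w \in z |` fset_set A)%fset -> vertex G w.
  rewrite !inE => /orP[/eqP ->//|]; rewrite in_fset_set// => /set_mem zw.
  by have [] := edge_vertex zw.
exists (z |` fset_set A)%fset; split; [exact: fset_uniq|exact: zV|].
move=> w Vw; rewrite !inE negb_or in_fset_set// => /andP[wz].
rewrite notin_setE => zw; apply: (cond_nonedge mu_cond) => //.
  by rewrite eq_sym.
by apply/negP.
Qed.

Lemma cond_vertex_gt0 z : vertex G z -> 0 < m z.
Proof.
move=> Vz; have [r [ur rV r0]] := cond_support Vz.
have [w zw] := infinite_connected_edge G_infinite G_connected Vz.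
have [_ Vw] := edge_vertex zw.
have mu0 : 0 < mu z w.
  have /andP[+ _] := cond_edge mu_cond zw; apply: lt_le_trans.
  by rewrite invr_gt0 (bound_gt0 mu_cond).
rewrite /cond_vertex (fsum_seq ur rV r0).
have rw : w \in r by apply: contraTT mu0 => /(r0 _ Vw) ->; rewrite ltxx.
rewrite (big_rem w)//= ltr_pwDl// big_seq sumr_ge0// => v /mem_rem /rV Vv.
exact: cond_ge0.
Qed.

Definition markov_op f z : R := (m z)^-1 * \sum_(w \in vertex G) mu z w * f w.

(** The inner product weighted by [cond_vertex]. A sum with infinitely many nonzero terms is 0 by
    convention, so its algebraic rules are stated under [finsupp]. *)
Definition dot f g : R := \sum_(z \in vertex G) m z * (f z * g z).

Definition finsupp f := finite_set (vertex G `&` [set z | f z != 0]).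

Lemma generatorE f z : vertex G z -> generator G mu f z = markov_op f z - f z.
Proof.
move=> Vz; have [r [ur rV r0]] := cond_support Vz.
rewrite /generator /markov_op; rewrite !(fsum_seq ur rV); first last.
- by move=> w Vw wr; rewrite r0// mul0r.
- by move=> w Vw wr; rewrite r0// mul0r.
have mr : m z = \sum_(w <- r) mu z w.
  by rewrite /cond_vertex (fsum_seq ur rV r0).
under eq_bigr do rewrite mulrBr.
rewrite sumrB -mulr_suml -mr mulrBr mulKf// gt_eqF//; exact: cond_vertex_gt0.
Qed.

(** Constants are annihilated; [c] serves for [f - lo] and [lo + om - f] in the oscillation
    argument. *)
Lemma generator_affine f g (a b c : R) z : vertex G z ->
  generator G mu (fun w => a * f w + b * g w + c) z =
  a * generator G mu f z + b * generator G mu g z.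
Proof.
move=> Vz; have [r [ur rV r0]] := cond_support Vz.
rewrite /generator !(fsum_seq ur rV);
  try by move=> w Vw wr; rewrite r0// mul0r.
rewrite !mulr_sumr -big_split/=; apply: eq_bigr => w _; ring.
Qed.

(** Four functions share the list because the symmetry of the Markov operator involves two functions
    and their two images. *)
Lemma finsupp_seq f g h l : finsupp f -> finsupp g -> finsupp h -> finsupp l ->
  exists r : seq V, [/\ uniq r, forall z, z \in r -> vertex G z &
    forall z, vertex G z -> z \notin r ->
      [/\ f z = 0, g z = 0, h z = 0 & l z = 0]].
Proof.
move=> ff fg fh fl.
pose S (k : V -> R) := vertex G `&` [set z | k z != 0].
pose A := S f `|` S g `|` (S h `|` S l).
have finA : finite_set A by rewrite !finite_setU.
have AV z : A z -> vertex G z by case=> [[]|[]] [].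
exists (fset_set A); split; first exact: fset_uniq.
  by move=> z; rewrite in_fset_set// => /set_mem; exact: AV.
move=> z Vz; rewrite in_fset_set// notin_setE => nAz.
have nz k : (S k `<=` A) -> k z = 0.
  by move=> SA; apply: contrapT => /eqP kz; apply: nAz; exact: SA.
by split; apply: nz => w Sw; [left; left|left; right|right; left|right; right].
Qed.

Lemma finsupp_op f : finsupp f -> finsupp (markov_op f).
Proof.
move=> ff; pose S := vertex G `&` [set z | f z != 0].
apply: (@sub_finite_set _ _ (\bigcup_(z in S) (z |` [set w | edge G z w]))).
  move=> z [Vz /= fz]; apply: contrapT => nS; move: fz; apply/negP; rewrite negbK.
  rewrite /markov_op fsbig1 ?mulr0// => w Vw.
  have [->|fw0] := eqVneq (f w) 0; first by rewrite mulr0.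
  have [zw|zw] := pselect (z = w \/ edge G z w).
    exfalso; apply: nS; exists w; first by split.
    by case: zw => [->|/(@edge_sym _ G)]; [left|right].
  rewrite (cond_nonedge mu_cond) ?mul0r//.
    by apply/eqP => zw'; apply: zw; left.
  by apply/negP => zw'; apply: zw; right.
apply: bigcup_finite => // z _; rewrite finite_setU; split => //.
exact: finite_neighbours.
Qed.

Lemma finsupp_lin f g (a b : R) : finsupp f -> finsupp g ->
  finsupp (fun z => a * f z + b * g z).
Proof.
move=> ff fg; apply: (@sub_finite_set _ _ ((vertex G `&` [set z | f z != 0])
   `|` (vertex G `&` [set z | g z != 0]))); last by rewrite finite_setU.
move=> z [Vz /=]; have [->|fz] := eqVneq (f z) 0; last by left.
by have [->|gz] := eqVneq (g z) 0; [rewrite !mulr0 addr0 eqxx|right].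
Qed.

Lemma dotC f g : dot f g = dot g f.
Proof. by rewrite /dot; apply: eq_fsbigr => z _; rewrite (mulrC (f z)). Qed.

Lemma dot_ge0 f : 0 <= dot f f.
Proof.
apply: fsumr_ge0 => z Vz; rewrite mulr_ge0 ?sqr_ge0//.
by rewrite ltW// cond_vertex_gt0.
Qed.

Lemma dotDl f g h (a b : R) : finsupp f -> finsupp g -> finsupp h ->
  dot (fun z => a * f z + b * g z) h = a * dot f h + b * dot g h.
Proof.
move=> ff fg fh; have [r [ur rV r0]] := finsupp_seq ff fg fh fh.
rewrite /dot !(fsum_seq ur rV); try by move=> z Vz /(r0 _ Vz)[? ? -> _]; ring.
rewrite !mulr_sumr -big_split/=; apply: eq_bigr => z _; ring.
Qed.

(** Detailed balance: the weight [m z] cancels the normalization of the operator and leaves the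
    kernel [mu], which is symmetric. *)
Lemma dot_op f g : finsupp f -> finsupp g ->
  dot (markov_op f) g = dot f (markov_op g).
Proof.
move=> ff fg.
have [r [ur rV r0]] := finsupp_seq ff fg (finsupp_op ff) (finsupp_op fg).
have dotE h k : finsupp k ->
    (forall z, vertex G z -> z \notin r -> h z = 0 /\ k z = 0) ->
    dot (markov_op h) k = \sum_(z <- r) \sum_(w <- r) mu z w * h w * k z.
  move=> fk hk0; rewrite /dot (fsum_seq ur rV); last first.
    by move=> z Vz zr; have [_ ->] := hk0 _ Vz zr; rewrite !mulr0.
  apply: eq_big_seq => z zr; rewrite /markov_op mulrA mulVKf; last first.
    by rewrite gt_eqF// cond_vertex_gt0//; exact: rV.
  rewrite (fsum_seq ur rV); last first.
    by move=> w Vw wr; have [-> _] := hk0 _ Vw wr; rewrite mulr0.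
  by rewrite mulr_suml.
rewrite dotE//; last by move=> z Vz /(r0 _ Vz)[? ? _ _].
rewrite [RHS]dotC dotE//; last by move=> z Vz /(r0 _ Vz)[? ? _ _].
rewrite exchange_big/=; apply: eq_big_seq => z zr; apply: eq_big_seq => w wr.
rewrite (cond_sym mu_cond (rV _ wr) (rV _ zr)); ring.
Qed.

(** With [g = markov_op f], twice [dot g g] is the sum of the terms [2 * mu z w * f w * g z], which
    is at most [dot f f + dot g g] because twice a product is at most the sum of the squares. *)
Lemma dot_op_le f : finsupp f -> dot (markov_op f) (markov_op f) <= dot f f.
Proof.
move=> ff; have fPf := finsupp_op ff.
have [r [ur rV r0]] := finsupp_seq ff fPf fPf fPf.
set g := markov_op f in fPf r0 *.
(* Only an inequality, as neighbours of [z] may lie outside of [r]; the list is enlarged by the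
   support [s] of [mu z]. *)
have row z : z \in r -> \sum_(w <- r) mu z w <= m z.
  move=> zr; have Vz := rV _ zr; have [s [us sV s0]] := cond_support Vz.
  rewrite /cond_vertex (@fsum_seq _ _ _ (undup (s ++ r))) ?undup_uniq//; last 2 first.
  - by move=> w; rewrite mem_undup mem_cat => /orP[/sV|/rV].
  - by move=> w Vw; rewrite mem_undup mem_cat negb_or => /andP[/(s0 _ Vw)].
  rewrite (fsbig_seq _ _ (undup_uniq _)) (fsbig_seq _ _ ur).
  rewrite -[leLHS]addr0.
  rewrite (@fsbigID _ _ _ _ [set` r] [set` undup (s ++ r)]); last exact: finite_seq.
  rewrite (_ : [set` undup (s ++ r)] `&` [set` r] = [set` r]); last first.
    apply/setIidPr => w /=; rewrite mem_undup mem_cat => ->; exact: orbT.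
  rewrite lerD2l fsumr_ge0// => w [/=]; rewrite mem_undup mem_cat => + _.
  by case/orP=> [/sV|/rV]; exact: cond_ge0.
have dE h : (forall z, vertex G z -> z \notin r -> h z = 0) ->
    dot h h = \sum_(z <- r) m z * (h z * h z).
  move=> h0; rewrite /dot (fsum_seq ur rV)// => z Vz zr.
  by rewrite h0// !mulr0.
have gg : dot g g = \sum_(z <- r) \sum_(w <- r) mu z w * f w * g z.
  rewrite dE; last by move=> z Vz /(r0 _ Vz)[].
  apply: eq_big_seq => z zr; rewrite {1}/g /markov_op mulrA mulVKf; last first.
    by rewrite gt_eqF// cond_vertex_gt0//; exact: rV.
  rewrite (fsum_seq ur rV) ?mulr_suml//.
  by move=> w Vw /(r0 _ Vw)[-> *]; rewrite mulr0.
have : dot g g + dot g g <= dot f f + dot g g.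
  rewrite {1 2}gg -big_split/= -[leLHS]mulr1 -[leLHS]mulr1.
  apply: (@le_trans _ _ (\sum_(z <- r) \sum_(w <- r)
      (mu z w * (f w * f w) + mu z w * (g z * g z)))).
    rewrite !mulr1 big_seq [leRHS]big_seq; apply: ler_sum => z zr.
    rewrite -big_split/= big_seq [leRHS]big_seq; apply: ler_sum => w wr.
    have := cond_ge0 (rV _ zr) (rV _ wr); have := sqr_ge0 (f w - g z).
    by move=> s0 m0; have := mulr_ge0 m0 s0; rewrite sqrrB !expr2; lra.
  under eq_bigr do rewrite big_split/=.
  rewrite big_split/= exchange_big/= lerD//.
    rewrite dE; last by move=> z Vz /(r0 _ Vz)[].
    rewrite big_seq [leRHS]big_seq; apply: ler_sum => z zr.
    rewrite -mulr_suml ler_wpM2r ?sqr_ge0//; apply: le_trans (row _ zr).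
    rewrite le_eqVlt; apply/orP; left; apply/eqP; apply: eq_big_seq => w wr.
    by rewrite (cond_sym mu_cond (rV _ wr) (rV _ zr)).
  rewrite dE; last by move=> z Vz /(r0 _ Vz)[].
  rewrite big_seq [leRHS]big_seq; apply: ler_sum => z zr.
  by rewrite -mulr_suml ler_wpM2r ?sqr_ge0//; exact: row.
by rewrite lerD2r.
Qed.

End reversible_operator.

(** * Decomposition of events along a countably valued map *)

Section fibers.
Context {disp : measure_display} {Omega : measurableType disp} {R : realType}
  {T : countType}.
Variables (P : {measure set Omega -> \bar R}) (X : Omega -> T).
Hypothesis mX : forall v, measurable (X @^-1` [set v]).

(** The fibers of [X] form a countable partition, and both sides are sums over it. With [c = 0] it
    serves to show that an event is null. *)
Lemma measure_fibers_scale (E F : set Omega) (c : R) :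
  0 <= c -> measurable E -> measurable F ->
  (forall v, P (E `&` X @^-1` [set v]) = (P (F `&` X @^-1` [set v]) * c%:E)%E) ->
  P E = (P F * c%:E)%E.
Proof.
(* The fibers are enumerated through [pickle]; a number that is not the code of a value of [X] gives
   the empty set. *)
move=> c0 mE mF EF; pose L i := [set w | choice.pickle (X w) = i].
have Lfiber i : L i = set0 \/ exists v, L i = X @^-1` [set v].
  have [->|/set0P[w Lw]] := eqVneq (L i) set0; first by left.
  right; exists (X w); apply/seteqP; split=> w' /=.
    by rewrite /L/= -Lw => /(pcan_inj choice.pickleK).
  by rewrite /L /= => ->.
have mL i : measurable (L i) by have [->|[v ->]] := Lfiber i.
have sumL A : measurable A -> P A = (\sum_(i <oo) P (A `&` L i))%E.
  move=> mA; transitivity (P (\bigcup_i (A `&` L i))).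
    congr (P _); apply/seteqP; split=> [w Aw|w [i _ []]//].
    by exists (choice.pickle (X w)).
  rewrite measure_bigcup//; last 2 first.
  - by move=> i _; exact: measurableI.
  - apply/trivIsetP => i j _ _ /eqP ij; apply/seteqP; split=> // w [[_ wi] [_ wj]].
    by apply: ij; rewrite -wi -wj.
  by apply: eq_eseriesl => i; rewrite in_setT.
rewrite (sumL E)// (sumL F)// muleC -nneseriesZl//.
apply: eq_eseriesr => i _; rewrite muleC.
by have [->|[v ->]] := Lfiber i; [rewrite !setI0 !measure0 mul0e|exact: EF].
Qed.

Lemma measure_fin_fibers (A : set T) (E : set Omega) : finite_set A ->
  measurable E ->
  P (E `&` X @^-1` A) = (\sum_(v \in A) P (E `&` X @^-1` [set v]))%E.
Proof.
move=> finA mE; rewrite -measure_fin_bigcup//; last 2 first.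
- apply/trivIsetP => u v _ _ /eqP uv; apply/seteqP; split=> // w [[_ /= wu] [_ /= wv]].
  by apply: uv; rewrite -wu -wv.
- by move=> v _; exact: measurableI.
congr (P _); apply/seteqP; split=> [w [Ew Aw]|w [v Av [Ew /= Xw]]].
  by exists (X w).
by split=> //; rewrite /preimage/= Xw.
Qed.

End fibers.

(** * The heat kernel: forward equation and Chapman-Kolmogorov identity *)

Section heat_kernel_recursion.
Context {R : realType} {d : nat} (G : lattice_subgraph d).
Local Notation V := 'rV[int]_d.
Variables (mu : V -> V -> R) (CM : R).
Hypothesis G_infinite : infinite_set (vertex G).
Hypothesis G_connected : connected_graph G.
Hypothesis mu_cond : conductances G mu CM.
Context {disp : measure_display} {Omega : measurableType disp}.
Variables (P : V -> probability Omega R) (X : nat -> Omega -> V).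
Hypothesis X_chain : markov_chain G mu P X.
Implicit Types (x y z w : V).
Local Notation m := (cond_vertex G mu).
Local Notation p := (heat_kernel G mu P X).

Let mX n v : measurable (X n @^-1` [set v]).
Proof. exact: (chain_measurable X_chain). Qed.

Let m_gt0 z : vertex G z -> 0 < m z.
Proof. exact: (cond_vertex_gt0 G_infinite G_connected mu_cond). Qed.

Lemma measurable_history (h : nat -> V) (k n : nat) :
  measurable [set w | forall i, (k <= i <= n)%N -> X i w = h i].
Proof.
rewrite (_ : [set w | _] =
    \bigcap_(i in [set i | (k <= i <= n)%N]) (X i @^-1` [set h i])); last first.
  by apply/seteqP; split=> w /= H i Hi; exact: H.
apply: fin_bigcap_measurable; last by move=> i _; exact: mX.
apply: (@sub_finite_set _ _ `I_n.+1); last exact: finite_II.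
by move=> i /= /andP[].
Qed.

(* Summing out the earliest coordinate of the history, one at a time. *)
Lemma chain_history_step x (h : nat -> V) (k n : nat) : vertex G x ->
  (forall i, vertex G (h i)) -> (k <= n)%N ->
  P x [set w | forall i, (k <= i <= n.+1)%N -> X i w = h i] =
  (P x [set w | forall i, (k <= i <= n)%N -> X i w = h i] *
   (mu (h n) (h n.+1) / m (h n))%:E)%E.
Proof.
move=> Vx; elim: k h => [|k IH] h Vh kn.
  exact: (chain_step X_chain).
apply: (@measure_fibers_scale _ _ _ _ _ (X k)) => //.
- by rewrite divr_ge0 ?(cond_ge0 mu_cond)// ltW// m_gt0.
- exact: measurable_history.
- exact: measurable_history.
move=> v; have [Vv|nVv] := pselect (vertex G v); last first.
  rewrite (_ : X k @^-1` [set v] = set0) ?setI0 ?measure0 ?mul0e//.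
  apply/seteqP; split=> // w /= Xv; apply: nVv; rewrite -Xv.
  exact: (chain_vertex X_chain).
(* Prescribing the value [v] at time [k] as well gives an event covered by the induction hypothesis.
   Since [k < n], the states [h n] and [h n.+1] are unchanged. *)
pose h' i := if i == k then v else h i.
have Vh' i : vertex G (h' i) by rewrite /h'; case: eqP.
have E l : (k <= l)%N -> [set w | forall i, (k < i <= l)%N -> X i w = h i]
    `&` X k @^-1` [set v] = [set w | forall i, (k <= i <= l)%N -> X i w = h' i].
  move=> kl; apply/seteqP; split=> w /=.
    move=> [H Xk] i /andP[ki il]; rewrite /h'; case: eqP => [->//|/eqP ik].
    by apply: H; rewrite il ltn_neqAle eq_sym ik ki.
  move=> H; split; last by have := H k; rewrite leqnn kl /h' eqxx; exact.
  move=> i /andP[ki il]; have := H i; rewrite (ltnW ki) il /h' gtn_eqF//.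
  exact.
rewrite !E ?(ltnW kn) ?leqW//; last exact: ltnW.
apply: (etrans (IH h' Vh' (ltnW kn))); congr (_ * (mu _ _ / m _)%:E)%E.
all: by rewrite /h' gtn_eqF// ltnW.
Qed.

(** The case [k = n] of [chain_history_step], in which the whole past has been summed out; the
    history is [z] up to time [n] and [y] afterwards. *)
Lemma chain_one_step x y z n : vertex G x -> vertex G y -> vertex G z ->
  P x (X n.+1 @^-1` [set y] `&` X n @^-1` [set z]) =
  (P x (X n @^-1` [set z]) * (mu z y / m z)%:E)%E.
Proof.
move=> Vx Vy Vz; pose h i := if (i <= n)%N then z else y.
have Vh i : vertex G (h i) by rewrite /h; case: ifP.
have hn : h n = z by rewrite /h leqnn.
have hn1 : h n.+1 = y by rewrite /h ltnn.
have := chain_history_step Vx Vh (leqnn n); rewrite hn hn1.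
rewrite (_ : [set w | _] = X n.+1 @^-1` [set y] `&` X n @^-1` [set z]); last first.
  apply/seteqP; split=> w /=.
    move=> H; split; first by rewrite H /h ?ltnn// leqnSn leqnn.
    by rewrite H /h ?leqnn// leqnSn.
  move=> [Xy Xz] i /andP[ni]; rewrite leq_eqVlt => /orP[/eqP ->|].
    by rewrite Xy /h ltnn.
  by rewrite ltnS => iN; rewrite /h iN -Xz; congr X; apply/eqP; rewrite eqn_leq iN.
move=> ->; congr (P x _ * _)%E; apply/seteqP; split=> w /=.
  by move=> H; rewrite H /h ?leqnn.
by move=> Xz i /andP[ni iN]; rewrite /h iN -Xz; congr X; apply/eqP; rewrite eqn_leq iN.
Qed.

Lemma heat_kernelE x y n : vertex G y ->
  P x (X n @^-1` [set y]) = (m y * p n x y)%:E.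
Proof.
move=> Vy; rewrite /heat_kernel mulrCA divff ?mulr1; last by rewrite gt_eqF// m_gt0.
by rewrite fineK ?fin_num_measure//; exact: mX.
Qed.

Lemma heat_kernel_ge0 x y n : vertex G y -> 0 <= p n x y.
Proof. by move=> Vy; rewrite divr_ge0 ?fine_ge0// ltW// m_gt0. Qed.

Lemma heat_kernel0 x y : vertex G x -> vertex G y ->
  p 0 x y = if x == y then (m y)^-1 else 0.
Proof.
move=> Vx Vy; have Px := chain_start X_chain Vx; rewrite /heat_kernel.
case: eqP => [<-|xy]; first by rewrite Px /= mul1r.
suff -> : P x [set w | X 0 w = y] = 0%E by rewrite /= mul0r.
apply/eqP; rewrite eq_le measure_ge0 andbT.
apply: (@le_trans _ _ (P x (~` [set w | X 0 w = x]))).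
  apply: le_measure; [exact/mem_set/(mX 0 y)|exact/mem_set/measurableC/(mX 0 x)|].
  by move=> w /= -> /esym.
by rewrite probability_setC ?Px ?subee//; exact: (mX 0 x).
Qed.

Lemma measurable_chain_in n A : finite_set A -> measurable (X n @^-1` A).
Proof.
move=> finA; rewrite (_ : X n @^-1` A = \bigcup_(v in A) (X n @^-1` [set v])).
  exact: fin_bigcup_measurable.
apply/seteqP; split=> [w rw|w [v rv /= Xv]]; first by exists (X n w).
by rewrite /preimage/= Xv.
Qed.

(** Kolmogorov's forward equation. After division by [m y], the symmetry of [mu] turns the sum over
    the predecessors of [y] into the Markov operator acting on the second variable. *)
Lemma heat_kernelS x y n : vertex G x -> vertex G y ->
  p n.+1 x y = markov_op G mu (p n x) y.
Proof.
move=> Vx Vy; have [r [ur rV r0]] := cond_support mu_cond Vy.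
have finr : finite_set [set` r] by exact: finite_seq.
have mr : measurable (X n @^-1` [set` r]) by exact: measurable_chain_in.
pose E := X n.+1 @^-1` [set y].
have mE : measurable E by exact: mX.
(* A jump to [y] from a state outside of [r] has probability 0, which leaves finitely many
   predecessors. *)
have off0 : P x (E `\` X n @^-1` [set` r]) = 0%E.
  rewrite -(mule0 (P x (E `\` X n @^-1` [set` r]))).
  apply: (@measure_fibers_scale _ _ _ _ _ (X n)) => //; try exact: measurableD.
  move=> z; rewrite mule0.
  have [zr|zr] := boolP (z \in r).
    rewrite (_ : _ `&` _ = set0) ?measure0//.
    by apply/seteqP; split=> // w [[_ /= +] Xz]; rewrite Xz.
  have [Vz|nVz] := pselect (vertex G z); last first.
    rewrite (_ : X n @^-1` [set z] = set0) ?setI0 ?measure0//.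
    apply/seteqP; split=> // w /= Xz; apply: nVz; rewrite -Xz.
    exact: (chain_vertex X_chain).
  apply/eqP; rewrite eq_le measure_ge0 andbT.
  apply: (@le_trans _ _ (P x (E `&` X n @^-1` [set z]))).
    apply: le_measure.
    - by apply/mem_set/measurableI => //; exact: measurableD.
    - by apply/mem_set; exact: measurableI.
    by move=> w [[]].
  by rewrite chain_one_step// (cond_sym mu_cond Vz Vy) r0// mul0r mule0.
have : P x E = P x (E `&` X n @^-1` [set` r]).
  apply: (etrans (measureDI _ mE mr)); rewrite -[RHS]add0e.
  by congr (_ + _)%E; exact: off0.
rewrite measure_fin_fibers//.
rewrite (eq_fsbigr (fun z => (mu y z * p n x z)%:E)); last first.
  move=> z /set_mem /= zr; have Vz := rV _ zr.
  rewrite chain_one_step// heat_kernelE// -EFinM; congr EFin.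
  rewrite (cond_sym mu_cond Vz Vy).
  by have := m_gt0 Vz => m0; field; rewrite gt_eqF.
rewrite fsumEFin// heat_kernelE// => -[] pE.
have mN0 : m y != 0 by rewrite gt_eqF// m_gt0.
apply: (mulfI mN0); rewrite pE /markov_op mulVKf//.
rewrite -fsbig_seq// (fsum_seq ur rV)// => z Vz zr.
by rewrite r0// mul0r.
Qed.

Lemma heat_kernel_sum x (A : set V) n : finite_set A -> A `<=` vertex G ->
  P x (X n @^-1` A) = (\sum_(y \in A) m y * p n x y)%:E.
Proof.
move=> finA AV; rewrite -[_ @^-1` A]setTI measure_fin_fibers//.
rewrite -fsumEFin//; apply: eq_fsbigr => y /set_mem/AV Vy.
by rewrite setTI; exact: heat_kernelE.
Qed.

Lemma heat_kernel_generator x y n : vertex G x -> vertex G y ->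
  p n.+1 x y - p n x y = generator G mu (p n x) y.
Proof.
move=> Vx Vy; rewrite (generatorE G_infinite G_connected mu_cond)//.
by rewrite heat_kernelS.
Qed.

Lemma heat_kernel_finsupp x n : vertex G x -> finsupp G (p n x).
Proof.
move=> Vx; elim: n => [|n IH].
  apply: (@sub_finite_set _ _ [set x]); last exact: finite_set1.
  move=> y [Vy /=]; rewrite heat_kernel0//; case: (x =P y) => [->//|_].
  by rewrite eqxx.
apply: sub_finite_set (finsupp_op mu_cond IH) => y [Vy /=].
by rewrite heat_kernelS.
Qed.

(** [p 0 y] is the indicator of [y] divided by [m y], so pairing with it evaluates at [y]. *)
Lemma dot_heat_kernel0 x y n : vertex G x -> vertex G y ->
  dot G mu (p n x) (p 0 y) = p n x y.
Proof.
move=> Vx Vy; rewrite /dot (@fsum_seq _ _ _ [:: y])//; last 2 first.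
- by move=> z; rewrite inE => /eqP ->.
- move=> z Vz; rewrite inE => zy; rewrite heat_kernel0//.
  by rewrite eq_sym (negbTE zy) !mulr0.
rewrite big_seq1 heat_kernel0// eqxx mulrCA divff ?mulr1//.
by rewrite gt_eqF// m_gt0.
Qed.

Lemma dot_markov_op_kernel f x n : vertex G x -> finsupp G f ->
  dot G mu (markov_op G mu f) (p n x) = dot G mu f (p n.+1 x).
Proof.
move=> Vx ff; rewrite (dot_op G_infinite G_connected mu_cond)//.
  rewrite /dot; apply: eq_fsbigr => z /set_mem Vz.
  by rewrite heat_kernelS.
exact: heat_kernel_finsupp.
Qed.

(** Chapman-Kolmogorov combined with reversibility: the steps of the second kernel are moved one by
    one to the first. *)
Lemma dot_heat_kernel x y k n : vertex G x -> vertex G y ->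
  dot G mu (p k x) (p n y) = p (k + n) x y.
Proof.
move=> Vx Vy; elim: n k => [|n IH] k; first by rewrite addn0 dot_heat_kernel0.
rewrite -dot_markov_op_kernel//; last exact: heat_kernel_finsupp.
rewrite addnS -addSn -IH; apply: eq_fsbigr => z /set_mem Vz.
by rewrite heat_kernelS.
Qed.

End heat_kernel_recursion.

(** * Second differences of decreasing sequences *)

Section decreasing_differences.
Context {R : realType}.

(** The telescoping sum [v k - v (k + n)] has [n] terms, each at least [u (k + n)]. *)
Lemma nonincreasing_difference_le (u v : nat -> R) (k n : nat) :
  (forall i, u i.+1 <= u i) -> (forall i, v i - v i.+1 = u i) ->
  n%:R * u (k + n)%N <= v k - v (k + n)%N.
Proof.
move=> udec uv; elim: n => [|n IH]; first by rewrite addn0 subrr mul0r.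
rewrite addnS -natr1; have := uv (k + n)%N; have := udec (k + n)%N.
move=> du dv; have : n%:R * u (k + n).+1 <= n%:R * u (k + n)%N.
  by rewrite ler_wpM2l.
move: IH du dv; move: (u (k + n).+1) (u (k + n)%N) (v (k + n).+1) => a b c.
rewrite mulrDl mul1r; lra.
Qed.

(* A nonnegative decreasing sequence whose second differences decrease has
   second differences of order [b h / h^2], as those of a completely monotone
   sequence. *)
Lemma second_difference_le (b : nat -> R) (h : nat) :
  let D k := b k - 2 * b k.+1 + b k.+2 in
  (forall k, 0 <= b k) -> (forall k, b k.+1 <= b k) ->
  (forall k, 0 <= D k) -> (forall k, D k.+1 <= D k) ->
  2 * h%:R ^+ 2 * D (4 * h)%N <= b h.
Proof.
move=> D b0 bdec D0 Ddec; pose e k := b k - b k.+1.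
have edec k : e k.+1 <= e k by have := D0 k; rewrite /D /e; lra.
have De k : e k - e k.+1 = D k by rewrite /D /e; lra.
(* Between [h] and [2h] for first differences, then between [2h] and [4h] for second ones:
   [h e(2h) <= b(h)] and [2h D(4h) <= e(2h)]. *)
have := nonincreasing_difference_le h h edec (fun k => erefl (e k)).
have := nonincreasing_difference_le (h + h) (h + h) Ddec De.
have e0 k : 0 <= e k by rewrite subr_ge0.
have := e0 (h + h + (h + h))%N; have := b0 (h + h)%N.
rewrite (_ : (4 * h = h + h + (h + h))%N); last lia.
move: (D _) (e (h + h)%N) (e _) (b _) (b h) => D4 e2 e4 b2 bh b20 e40 D4e e2b.
have : (h%:R : R) * ((h + h)%:R * D4) <= h%:R * e2.
  by rewrite ler_wpM2l//; lra.
rewrite natrD; move: (h%:R) e2b => H; lra.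
Qed.

End decreasing_differences.

(** * Averages over consecutive times *)

Section averages.
Context {R : realType}.

(* Shifted backwards in time, so that the value at the last time of a time
   interval is kept; at time 0 the predecessor is 0 itself. *)
Definition avg (T : Type) (f : nat -> T -> R) : nat -> T -> R :=
  fun n z => (f n z + f n.-1 z) / 2.

(** An average preserves a bound on the increments and moves the value by at most half of it, while
    the range of times loses one unit on the left. *)
Lemma avg_iter_close (T : Type) (f : nat -> T -> R) (z : T) (eta : R)
    (N M j : nat) :
  (forall n, (N < n <= M)%N -> `|f n z - f n.-1 z| <= eta) ->
  forall n, (N + j < n <= M)%N ->
  `|iter j (@avg T) f n z - iter j (@avg T) f n.-1 z| <= eta /\
  `|iter j (@avg T) f n z - f n z| <= j%:R * eta.
Proof.
move=> fz; elim: j => [|j IH] n nNM.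
  by rewrite subrr normr0 mul0r; split=> //; apply: fz; lia.
have [d1 c1] : _ /\ _ := IH n ltac:(lia).
have [d2 c2] : _ /\ _ := IH n.-1 ltac:(lia).
rewrite iterS /avg -[j.+1%:R]natr1; move: (iter j _ f) d1 c1 d2 c2 => g.
rewrite !ler_norml [(_ + 1) * _]mulrDl mul1r.
move=> /andP[? ?] /andP[? ?] /andP[? ?] /andP[? ?].
by split; apply/andP; split; lra.
Qed.

End averages.

(** * Decay of the oscillation of caloric functions *)

Section regularity.
Context {R : realType} {d : nat} (G : lattice_subgraph d).
Local Notation V := 'rV[int]_d.
Variables (mu : V -> V -> R) (CM : R).
Hypothesis G_infinite : infinite_set (vertex G).
Hypothesis G_connected : connected_graph G.
Hypothesis mu_cond : conductances G mu CM.
Implicit Types (x y z w : V) (f : nat -> V -> R) (r : R).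

Lemma PHI_le (CH : R) y r (u : nat -> V -> R) (n n' : nat) z z' :
  0 <= CH -> PHI G mu CH y r (r ^+ 2) ->
  (forall k w, k%:R <= r ^+ 2 -> gclosure G (gball G y r) w -> 0 <= u k w) ->
  caloric G mu y r (r ^+ 2) u ->
  r ^+ 2 / 4 <= n%:R <= r ^+ 2 / 2 -> n.+1%:R <= r ^+ 2 ->
  gball G y (r / 2) z ->
  3 / 4 * r ^+ 2 <= n'%:R <= r ^+ 2 -> n'.+1%:R <= r ^+ 2 ->
  gball G y (r / 2) z' ->
  u n.+1 z + u n z <= CH * (u n'.+1 z' + u n' z').
Proof.
move=> CH0 phi u0 cu nr nr1 zr nr' nr1' zr'.
have := phi u u0 cu; rewrite -lee_fin EFinM => sup_inf.
apply: le_trans (le_trans _ sup_inf) _.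
  by apply: ereal_sup_ubound; exists n, z.
rewrite lee_wpmul2l ?lee_fin//.
by apply: ereal_inf_lbound; exists n', z'.
Qed.

(** The starting time is recorded because an average at time [n] involves time [n - 1]: each
    averaging raises [j] by one. *)
Definition caloric_from (j : nat) f := forall n z, (j <= n)%N -> vertex G z ->
  f n.+1 z - f n z = generator G mu (f n) z.

Lemma caloric_avg (j : nat) f : caloric_from j f -> caloric_from j.+1 (avg f).
Proof.
move=> cf [//|n] z jn Vz; have c1 := cf n.+1 z (ltnW jn) Vz.
have c0 := cf n z jn Vz.
rewrite (_ : avg f n.+1 = fun w => 2^-1 * f n.+1 w + 2^-1 * f n w + 0); last first.
  by apply/funext => w; rewrite /avg/=; lra.
by rewrite (generator_affine mu_cond)// -c1 -c0 /avg/=; lra.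
Qed.

(** Moves time [s] to the origin, where [PHI] is stated, and allows for the two affine images of [f]
    to which it is applied. *)
Lemma caloric_shift (j s : nat) f (a c : R) y r T : caloric_from j f ->
  (j <= s)%N -> caloric G mu y r T (fun n z => a * f (s + n)%N z + c).
Proof.
move=> cf js n z _ [Vz _].
rewrite (_ : (fun w => _) =
    fun w => a * f (s + n)%N w + 0 * f (s + n)%N w + c); last first.
  by apply/funext => w; rewrite mul0r addr0.
rewrite (generator_affine mu_cond)// -(cf (s + n)%N)//; last lia.
by rewrite addnS; lra.
Qed.

(* [f - lo] and [lo + om - f] are both nonnegative and caloric, and comparing
   the values of each in [Q_+] to those at a single point of [Q_-] shrinks the
   oscillation. Harnack only controls the sums over two consecutive times,
   whence the average in the conclusion. *)
Lemma oscillation_step (CH : R) y r f (j M : nat) (lo om : R) :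
  0 < CH -> vertex G y -> 4 <= r -> PHI G mu CH y r (r ^+ 2) ->
  caloric_from j f -> j%:R + r ^+ 2 <= M%:R ->
  (forall n z, M%:R - r ^+ 2 <= n%:R -> (n <= M)%N -> gball G y (2 * r) z ->
    lo <= f n z <= lo + om) ->
  exists lo', forall n z, M%:R - (r / 4) ^+ 2 <= n%:R -> (n <= M)%N ->
    gball G y (r / 2) z ->
    lo' <= avg f n z <= lo' + om * (1 - (CH + 1)^-1).
Proof.
move=> CH0 Vy r4 phi cf jrM fb.
have r16 : 16 <= r ^+ 2 by rewrite expr2; nra.
have r2_ge0 : 0 <= r ^+ 2 by lra.
pose q := Num.truncn (r ^+ 2).
have [q1 q2] : q%:R <= r ^+ 2 /\ r ^+ 2 < q.+1%:R.
  by split; [rewrite truncn_le|rewrite truncnS_gt].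
clearbody q.
have jqM : (j + q <= M)%N by rewrite -(ler_nat R) natrD; lra.
(* The cylinder starts at time [s], so that its last integer time [q] corresponds to [M]. *)
pose s := (M - q)%N.
have sq : (s + q = M)%N by rewrite /s subnK// (leq_trans _ jqM)// leq_addl.
have sM : s%:R = M%:R - q%:R :> R by rewrite -sq natrD addrK.
have js : (j <= s)%N by rewrite /s leq_subRL 1?addnC// (leq_trans _ jqM)// leq_addl.
clearbody s.
(* An integer time in the range of [Q_-]; it stays below [r ^+ 2 / 2] because [r ^+ 2] is at least
   16. *)
pose n0 := (Num.truncn (r ^+ 2 / 4)).+1.
have [n01 n02] : n0%:R <= r ^+ 2 / 4 + 1 /\ r ^+ 2 / 4 <= n0%:R.
  split; last by rewrite ltW// truncnS_gt.
  by rewrite /n0 -natr1 lerD2r truncn_le//; lra.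
clearbody n0.
have yr : gball G y (r / 2) y by split=> //; rewrite gdistxx; lra.
have r1 : 1 <= r by lra.
have bounds k w : k%:R <= r ^+ 2 -> gclosure G (gball G y r) w ->
    lo <= f (s + k)%N w <= lo + om.
  move=> kr /(gclosure_gball G_connected Vy r1) wr; apply: fb => //.
    by rewrite natrD sM; have := ler0n R k; lra.
  rewrite -sq leq_add2l -ltnS -(ltr_nat R).
  exact: le_lt_trans q2.
pose A := f (s + n0.+1)%N y + f (s + n0)%N y.
(* Harnack gives [A - 2 lo <= CH (a + b - 2 lo)] for the values [a], [b] of [f] at two consecutive
   times. Adding [0 <= a + b - 2 lo] replaces [CH] by [CH + 1], so that the contraction factor is
   nonnegative. The upper bound is symmetric. *)
exists (lo + (A - 2 * lo) / (2 * (CH + 1))) => n z nM1 nM zr.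
have nr : M%:R - r ^+ 2 / 16 <= n%:R by move: nM1; rewrite expr_div_n; lra.
have sn : (s < n)%N by rewrite -(ltr_nat R) sM; move: q2; rewrite -natr1; lra.
(* Harnack at time [k] of the cylinder bounds the sum of [f] at times [n.-1] and [n], which is twice
   [avg f n]. *)
pose k := (n.-1 - s)%N.
have nk : (n = s + k.+1)%N by rewrite /k; move: sn; clear; lia.
have kq : (k.+1 <= q)%N by rewrite /k; move: sn sq nM; clear; lia.
clearbody k.
have kq' : k.+1%:R <= q%:R :> R by rewrite ler_nat.
have kn : k%:R = n%:R - s%:R - 1 :> R.
  by rewrite nk natrD -[k.+1%:R]natr1; lra.
move: q2 kq'; rewrite -[q.+1%:R]natr1 -[k.+1%:R]natr1 => q2 kq'.
have k1 : 3 / 4 * r ^+ 2 <= k%:R <= r ^+ 2 by apply/andP; split; lra.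
have k2 : k.+1%:R <= r ^+ 2 by rewrite -natr1; lra.
have n0r : r ^+ 2 / 4 <= n0%:R <= r ^+ 2 / 2 by apply/andP; split; lra.
have n0r1 : n0.+1%:R <= r ^+ 2 by rewrite -natr1; lra.
have cal a c := @caloric_shift j s f a c y r (r ^+ 2) cf js.
have lower := PHI_le (ltW CH0) phi (u := fun n z => 1 * f (s + n)%N z + - lo)
  ltac:(by move=> i w ir wr; have /andP[] := bounds i w ir wr; lra)
  (cal _ _) n0r n0r1 yr k1 k2 zr.
have upper := PHI_le (ltW CH0) phi (u := fun n z => -1 * f (s + n)%N z + (lo + om))
  ltac:(by move=> i w ir wr; have /andP[] := bounds i w ir wr; lra)
  (cal _ _) n0r n0r1 yr k1 k2 zr.
have fz1 : lo <= f n z <= lo + om.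
  apply: fb => //; first lra.
  by have [Vz zr2] := zr; split=> //; apply: lt_le_trans zr2 _; lra.
have fz0 : lo <= f n.-1 z <= lo + om.
  apply: fb; first by rewrite nk addnS /= natrD; lra.
    by rewrite (leq_trans (leq_pred n)).
  by have [Vz zr2] := zr; split=> //; apply: lt_le_trans zr2 _; lra.
have np : n.-1 = (s + k)%N by rewrite nk addnS.
move: lower upper fz1 fz0; rewrite /avg np nk.
rewrite -/A; move: (f (s + k.+1)%N z) (f (s + k)%N z) => a b.
have -> : 1 * f (s + n0.+1)%N y + - lo + (1 * f (s + n0)%N y + - lo) = A - 2 * lo.
  by rewrite /A; lra.
have -> : -1 * f (s + n0.+1)%N y + (lo + om) + (-1 * f (s + n0)%N y + (lo + om))
  = 2 * (lo + om) - A by rewrite /A; lra.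
move=> lower upper /andP[a1 a2] /andP[b1 b2].
have c0 : 0 < 2 * (CH + 1) by lra.
have -> : lo + (A - 2 * lo) / (2 * (CH + 1)) + om * (1 - (CH + 1)^-1) =
    lo + om - (2 * (lo + om) - A) / (2 * (CH + 1)).
  by field; rewrite gt_eqF//; lra.
apply/andP; split.
  by rewrite -lerBrDl ler_pdivrMr//; nra.
by rewrite lerBrDr -lerBrDl ler_pdivrMr//; nra.
Qed.

(** Radii are divided by 4, since the conclusion of one step, on the ball of radius [r / 2], is the
    hypothesis of the next on twice the radius [r / 4]. The term [K%:R] makes room for the initial
    times lost by averaging. *)
Lemma oscillation_iter (CH : R) y r f (M : nat) (om : R) (K : nat) :
  0 < CH -> vertex G y -> caloric_from 0 f ->
  K%:R + r ^+ 2 <= M%:R -> 0 <= r ->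
  (forall j, (j < K)%N -> 4 <= r / 4 ^+ j /\
    PHI G mu CH y (r / 4 ^+ j) ((r / 4 ^+ j) ^+ 2)) ->
  (exists lo, forall n z, M%:R - r ^+ 2 <= n%:R -> (n <= M)%N ->
    gball G y (2 * r) z -> lo <= f n z <= lo + om) ->
  exists lo, forall n z, M%:R - (r / 4 ^+ K) ^+ 2 <= n%:R -> (n <= M)%N ->
    gball G y (2 * (r / 4 ^+ K)) z ->
    lo <= iter K (@avg R V) f n z <= lo + om * (1 - (CH + 1)^-1) ^+ K.
Proof.
move=> CH0 Vy cf; elim: K => [|K IH] KM r0 phi f0.
  by rewrite expr0 divr1 mulr1.
have KM' : K%:R + r ^+ 2 <= M%:R by move: KM; rewrite -natr1; lra.
have [lo osc] := IH KM' r0 (fun j jK => phi j (ltnW jK)) f0.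
have [r4 phiK] := phi K (ltnSn K).
have cK : caloric_from K (iter K (@avg R V) f).
  elim: K {IH KM KM' phi osc r4 phiK} => [//|K IH]; exact: caloric_avg.
have rr : (r / 4 ^+ K) ^+ 2 <= r ^+ 2.
  have e1 : 1 <= (4 : R) ^+ K by rewrite exprn_ege1//; lra.
  rewrite ler_sqr ?nnegrE ?divr_ge0// ?exprn_ge0//.
  by rewrite ler_pdivrMr ?(lt_le_trans ltr01)// ler_peMr.
have KrM : K%:R + (r / 4 ^+ K) ^+ 2 <= M%:R by lra.
have [lo' osc'] := oscillation_step CH0 Vy r4 phiK cK KrM osc.
have E1 : r / 4 ^+ K.+1 = r / 4 ^+ K / 4.
  by rewrite exprSr; field; rewrite expf_neq0.
have E2 : 2 * (r / 4 ^+ K.+1) = r / 4 ^+ K / 2 by rewrite E1; lra.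
exists lo' => n z; rewrite E2 E1 [(1 - _) ^+ _]exprSr mulrA => nM1 nM zr.
by rewrite iterS; exact: osc'.
Qed.

End regularity.

(** * Time regularity and diagonal bounds of the heat kernel *)

Section kernel_regularity.
Context {R : realType} {d : nat} (G : lattice_subgraph d).
Local Notation V := 'rV[int]_d.
Variables (mu : V -> V -> R) (CM : R).
Hypothesis G_infinite : infinite_set (vertex G).
Hypothesis G_connected : connected_graph G.
Hypothesis mu_cond : conductances G mu CM.
Implicit Types (x y z w : V) (f : nat -> V -> R) (r : R).

Context {disp : measure_display} {Omega : measurableType disp}.
Variables (P : V -> probability Omega R) (X : nat -> Omega -> V).
Hypothesis X_chain : markov_chain G mu P X.
Local Notation p := (heat_kernel G mu P X).
Local Notation dot := (dot G mu).

Lemma caloric_heat_kernel x : vertex G x -> caloric_from G mu 0 (fun n => p n x).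
Proof.
move=> Vx n z _ Vz.
exact: (heat_kernel_generator G_infinite G_connected mu_cond X_chain).
Qed.

(** Expanding the square by Chapman-Kolmogorov gives the kernels at times [2k + 4], [2k + 2] and
    [2k]. *)
Lemma heat_kernel_diag_second_difference x (k : nat) : vertex G x ->
  let b k := p (k + k) x x in
  b k - 2 * b k.+1 + b k.+2 =
  dot (fun z => 1 * p k.+2 x z + (-1) * p k x z)
      (fun z => 1 * p k.+2 x z + (-1) * p k x z).
Proof.
move=> Vx b; have fin n := heat_kernel_finsupp G_infinite G_connected mu_cond X_chain n Vx.
have dotE := dot_heat_kernel G_infinite G_connected mu_cond X_chain.
rewrite (dotDl _ 1 (-1)) => //; last exact: finsupp_lin.
rewrite !(dotC _ _ (p _ x)) !(dotDl _ 1 (-1)) => //.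
rewrite !dotE// /b !addnS !addSn; lra.
Qed.

Lemma heat_kernel_time_regularity x z (a h m : nat) (lam : R) :
  vertex G x -> vertex G z -> 0 < lam -> (0 < h)%N -> (4 * h <= a)%N ->
  2 * `|p (a + m).+2 x z - p (a + m) x z| <=
  lam * (p (h + h) x x / (2 * h%:R ^+ 2)) + lam^-1 * p (m + m) z z.
Proof.
move=> Vx Vz lam0 h0 ha.
have fin n := heat_kernel_finsupp G_infinite G_connected mu_cond X_chain n Vx.
have finz n := heat_kernel_finsupp G_infinite G_connected mu_cond X_chain n Vz.
have dotE := dot_heat_kernel G_infinite G_connected mu_cond X_chain.
have dge0 := dot_ge0 G_infinite G_connected mu_cond.
pose u k z := 1 * p k.+2 x z + (-1) * p k x z.
have finu k : finsupp G (u k) by exact: finsupp_lin.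
pose b k := p (k + k) x x; pose D k := b k - 2 * b k.+1 + b k.+2.
have DE k : D k = dot (u k) (u k) by exact: heat_kernel_diag_second_difference.
(* Contraction of the operator makes both [b] and its second differences [D], which are squared
   norms, decrease. *)
have opE (f g : V -> R) : (forall w, vertex G w -> f w = markov_op G mu g w) ->
    finsupp G g -> dot f f <= dot g g.
  move=> fg fing; rewrite (_ : dot f f = dot (markov_op G mu g) (markov_op G mu g)).
    exact: (dot_op_le G_infinite G_connected mu_cond).
  by rewrite /dot; apply: eq_fsbigr => w /set_mem Vw; rewrite fg.
have pS := heat_kernelS G_infinite G_connected mu_cond X_chain.
have bdec k : b k.+1 <= b k.
  by rewrite /b -!dotE//; apply: opE => // w Vw; exact: pS.
have Ddec k : D k.+1 <= D k.
  rewrite !DE; apply: opE => // w Vw; rewrite /u !pS//.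
  have := @generator_affine _ _ _ _ _ mu_cond (p k.+2 x) (p k x) 1 (-1) 0 w Vw.
  rewrite !(generatorE G_infinite G_connected mu_cond)//.
  rewrite (_ : (fun _ => _ + 0) = u k); last by apply/funext => v; rewrite addr0.
  by rewrite /u; lra.
have Dmono k l : (k <= l)%N -> D l <= D k.
  move=> /subnK <-; elim: (l - k)%N => [//|i IH].
  by rewrite addSn; apply: le_trans IH.
have b0 k : 0 <= b k by exact: (heat_kernel_ge0 G_infinite G_connected mu_cond).
have D0 k : 0 <= D k by rewrite DE.
have D4 := second_difference_le h b0 bdec D0 Ddec.
have DaD : D a <= p (h + h) x x / (2 * h%:R ^+ 2).
  apply: le_trans (Dmono _ _ ha) _.
  by rewrite ler_pdivlMr 1?mulrC// mulr_gt0// exprn_gt0// ltr0n.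
have dE : p (a + m).+2 x z - p (a + m) x z = dot (u a) (p m z).
  by rewrite (dotDl _ 1 (-1))// !dotE// !addSn; lra.
(* The squared norm of [lam * u a + e * p m z] is nonnegative; the two signs of [e] bound the
   absolute value of the inner product. *)
have amgm (e : R) : e ^+ 2 = 1 ->
    0 <= lam ^+ 2 * D a + 2 * e * lam * dot (u a) (p m z) + p (m + m) z z.
  move=> e1; pose W w := lam * u a w + e * p m z w.
  have fl : finsupp G W by exact: finsupp_lin.
  have := dge0 W; rewrite {1}/W (dotDl _ lam e)//.
  rewrite (dotC _ _ (u a) W) (dotC _ _ (p m z) W) /W !(dotDl _ lam e)//.
  rewrite (dotC _ _ (p m z) (u a)) -DE dotE//; move: e1 (dot _ _) (D a) (p _ z z).
  move=> e1 S A C; have : e * (e * C) = C by rewrite mulrA -expr2 e1 mul1r.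
  lra.
rewrite dE; have := amgm 1; have := amgm (-1); rewrite sqrrN !expr1n.
move=> /(_ erefl) m1 /(_ erefl) p1.
have key : 2 * `|dot (u a) (p m z)| * lam <= lam ^+ 2 * D a + p (m + m) z z.
  have [s0|s0] := lerP 0 (dot (u a) (p m z)).
    by rewrite ger0_norm//; lra.
  by rewrite ltr0_norm//; lra.
rewrite -(ler_pM2r lam0) (le_trans key)// mulrDl (mulrAC lam^-1) mulVf ?gt_eqF//.
by rewrite mul1r lerD2r [leRHS]mulrAC -expr2 ler_wpM2l ?sqr_ge0.
Qed.

(** Harnack bounds [p m z z] by the sum of [p k z w] and [p k.+1 z w] at a later time [k], for every
    [w] in [A]. Weighted by [cond_vertex] and summed over [A], each of the two gives a probability,
    whence the factor 2. *)
Lemma heat_kernel_diag_le (CH : R) y r z (A : set V) (m : nat) :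
  0 < CH -> vertex G y -> 4 <= r -> PHI G mu CH y r (r ^+ 2) ->
  finite_set A -> A `<=` gball G y (r / 2) -> gball G y (r / 2) z ->
  r ^+ 2 / 4 <= m%:R <= r ^+ 2 / 2 ->
  p m z z * cond_measure G mu A <= 2 * CH.
Proof.
move=> CH0 Vy r4 phi finA Ar zr mr; have [Vz _] := zr.
have r16 : 16 <= r ^+ 2 by rewrite expr2; nra.
have AV : A `<=` vertex G by move=> w /Ar[].
have p0 := heat_kernel_ge0 G_infinite G_connected mu_cond.
pose q := Num.truncn (r ^+ 2).
have [q1 q2] : q%:R <= r ^+ 2 /\ r ^+ 2 < q.+1%:R.
  by split; [rewrite truncn_le; lra|rewrite truncnS_gt].
clearbody q.
have q0 : (0 < q)%N by rewrite -(ltr_nat R); move: q2; rewrite -natr1; lra.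
(* The last time allowed in [Q_+], as [k.+1] must not exceed [r ^+ 2]. *)
pose k := q.-1.
have qk : q = k.+1 by rewrite /k prednK.
clearbody k.
have kE : k%:R = q%:R - 1 :> R by rewrite qk -natr1 addrK.
have k1 : 3 / 4 * r ^+ 2 <= k%:R <= r ^+ 2.
  by move: q2; rewrite -natr1; move=> q2; apply/andP; split; lra.
have k2 : k.+1%:R <= r ^+ 2 by rewrite -qk.
have m1 : m.+1%:R <= r ^+ 2 by have /andP[_] := mr; rewrite -natr1; lra.
have cal : caloric G mu y r (r ^+ 2) (fun n => p n z).
  move=> n w _ [Vw _].
  exact: (heat_kernel_generator G_infinite G_connected mu_cond X_chain).
have nn n w : n%:R <= r ^+ 2 -> gclosure G (gball G y r) w -> 0 <= p n z w.
  by move=> _ [[Vw _]|[Vw _ _]]; exact: p0.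
have mass n : \sum_(w \in A) cond_vertex G mu w * p n z w <= 1.
  rewrite -lee_fin -(heat_kernel_sum G_infinite G_connected mu_cond X_chain)//.
  by apply: probability_le1; exact: (measurable_chain_in X_chain).
have {}mass n : \sum_(w <- fset_set A) cond_vertex G mu w * p n z w <= 1.
  by rewrite -fsbig_finite.
rewrite /cond_measure fsbig_finite// mulr_sumr.
have step w : w \in fset_set A -> p m z z * cond_vertex G mu w <=
    CH * (cond_vertex G mu w * p k.+1 z w + cond_vertex G mu w * p k z w).
  rewrite in_fset_set// => /set_mem Aw; have [Vw _] := Ar _ Aw.
  have m0 := cond_vertex_gt0 G_infinite G_connected mu_cond Vw.
  have := PHI_le (ltW CH0) phi nn cal mr m1 zr k1 k2 (Ar _ Aw).
  have := p0 _ _ P X z z m.+1 Vz => pp0 ph.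
  rewrite -mulrDr mulrCA mulrC ler_pM2l//; lra.
rewrite big_seq; apply: le_trans (ler_sum _ step) _.
rewrite -big_seq -mulr_sumr big_split/= (mulrC 2) ler_pM2l//.
by have := mass k; have := mass k.+1; lra.
Qed.

End kernel_regularity.

(** * The Gaussian kernel on small boxes *)

Section gaussian_box.
Context {R : realType} {d : nat}.
Implicit Types (x y : 'rV[R]_d) (r : R).

Lemma measurable_gauss_tuple (D t : R) :
  measurable_fun setT (fun v : d.-tuple (measurableTypeR R) =>
    gauss_kernel D t (\row_i tnth v i)).
Proof.
rewrite (_ : (fun v => _) = (fun v : d.-tuple (measurableTypeR R) =>
    (2 * pi * t * D) `^ (- (d%:R / 2)) *
    expR (- ((\sum_(i < d) tnth v i ^+ 2) / (2 * D * t))))); last first.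
  apply/funext => v; rewrite /gauss_kernel /enorm sqr_sqrtr; last first.
    by apply: sumr_ge0 => i _; exact: sqr_ge0.
  by under eq_bigr do rewrite mxE.
apply: measurable_funM => //; apply: measurableT_comp => //.
apply: measurable_funN; apply: measurable_funM => //.
apply: measurable_sum => i; apply: measurable_funX; exact: measurable_tnth.
Qed.

Lemma lebesgue_integral_box_bounds (D t lo hi r : R) x :
  0 < r -> 0 <= lo ->
  (forall y, box x r y -> lo <= gauss_kernel D t y <= hi) ->
  ((lo * (2 * r) ^+ d)%:E <= lebesgue_integral_Rd (box x r) (gauss_kernel D t)
     <= (hi * (2 * r) ^+ d)%:E)%E.
Proof.
move=> r0 lo0 bnd; rewrite /lebesgue_integral_Rd.
set pt := fun v : d.-tuple (measurableTypeR R) => \row_i tnth v i.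
pose A i : set (measurableTypeR R) := `[x 0 i - r, x 0 i + r]%classic.
have boxE : pt @^-1` (box x r) = [set v | forall i, A i (tnth v i)].
  apply/seteqP; split=> v /= H i; first by have := H i; rewrite mxE /A /= in_itv.
  by have := H i; rewrite mxE /A /= in_itv.
have mA i : measurable (A i) by exact: measurable_itv.
have vol : lebesgue_tuple R d (pt @^-1` (box x r)) = ((2 * r) ^+ d)%:E.
  rewrite boxE lebesgue_tuple_box//.
  transitivity (\prod_(i < d) (2 * r)%:E)%E; last first.
    by rewrite prodEFin big_const_ord iter_mulr_1.
  apply: eq_bigr => i _; rewrite lebesgue_measure_itv /= lte_fin.
  by rewrite ifT ?ltrBlDr -?addrA ?ltrDl -?EFinD//; [congr EFin; lra|lra].
have mbox : measurable (pt @^-1` (box x r)).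
  rewrite boxE (_ : [set v | _] = \bigcap_(i in [set: 'I_d])
      ((@tnth _ (measurableTypeR R))^~ i @^-1` A i)).
    apply: fin_bigcap_measurable; first exact: finite_finset.
    by move=> i _; rewrite -[X in measurable X]setTI; apply: (measurable_tnth i).
  by apply/seteqP; split=> v /= H i; [move=> _|]; exact: H.
have mg : measurable_fun (pt @^-1` (box x r)) (fun v => (gauss_kernel D t (pt v))%:E).
  by apply/measurable_EFinP; apply: measurable_funS (measurable_gauss_tuple D t).
have volc c : (\int[lebesgue_tuple R d]_(v in pt @^-1` (box x r)) c%:E)%E =
    (c * (2 * r) ^+ d)%:E.
  by rewrite integral_cst// EFinM; congr (_ * _)%E; exact: vol.
have ge_lo v : (pt @^-1` box x r) v -> lo <= gauss_kernel D t (pt v) by move=> /bnd/andP[].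
apply/andP; split; rewrite -volc; apply: ge0_le_integral => //.
- by move=> v /ge_lo gl; rewrite lee_fin (le_trans lo0).
- by move=> v /= /bnd/andP[]; rewrite lee_fin.
Qed.

Lemma gauss_kernel_continuous (D t : R) x (eps : R) : 0 < eps ->
  exists2 r0, 0 < r0 & forall y, box x r0 y ->
    `|gauss_kernel D t y - gauss_kernel D t x| <= eps.
Proof.
move=> e0; pose F (s : R) := (2 * pi * t * D) `^ (- (d%:R / 2)) * expR (- (s / (2 * D * t))).
have kE y : gauss_kernel D t y = F (\sum_(i < d) y 0 i ^+ 2).
  by rewrite /gauss_kernel /enorm sqr_sqrtr// sumr_ge0// => i _; exact: sqr_ge0.
have cF s : {for s, continuous F}.
  apply: cvgM; first exact: cvg_cst.
  apply: continuous_comp; last exact: continuous_expR.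
  by apply: cvgN; apply: cvgM; [exact: cvg_id|exact: cvg_cst].
have [a a0 Ha] : exists2 a, 0 < a & forall s, `|s - \sum_(i < d) x 0 i ^+ 2| < a ->
    `|F s - F (\sum_(i < d) x 0 i ^+ 2)| <= eps.
  have /cvgrPdist_le/(_ _ e0)/nbhs_ballP[a /= a0 Ha] := cF (\sum_(i < d) x 0 i ^+ 2).
  by exists a => // s sa; rewrite distrC; apply: Ha; rewrite /ball/= distrC.
(* For a half-side [e <= 1] one has [|y_i + x_i| <= 2 |x_i| + 1], so the sum of squares varies by at
   most [e * S]. *)
pose S := \sum_(i < d) (2 * `|x 0 i| + 1).
have S0 : 0 <= S by apply: sumr_ge0 => i _; rewrite addr_ge0// mulr_ge0.
exists (Num.min 1 (a / (S + 1))) => [|y yx].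
  by rewrite lt_min ltr01 divr_gt0// ltr_wpDl.
rewrite !kE; apply: Ha; rewrite -sumrB.
have S1 : 0 < S + 1 by rewrite ltr_wpDl.
have [m1 m2] : Num.min 1 (a / (S + 1)) <= 1 /\ Num.min 1 (a / (S + 1)) * (S + 1) <= a.
  by split; [rewrite ge_min lexx|rewrite -ler_pdivlMr// ge_min lexx orbT].
have m0 : 0 < Num.min 1 (a / (S + 1)) by rewrite lt_min ltr01 divr_gt0.
move: (Num.min _ _) m0 m1 m2 yx => e e_gt0 e1 e2 yx.
apply: (@le_lt_trans _ _ (e * S)); last nra.
rewrite (le_trans (ler_norm_sum _ _ _))// mulr_sumr; apply: ler_sum => i _.
have /andP[yl yu] := yx i.
have ye : `|y 0 i - x 0 i| <= e by rewrite ler_norml; lra.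
rewrite subr_sqr normrM mulrC; rewrite (mulrC e) ler_pM//.
rewrite (_ : y 0 i + x 0 i = 2 * x 0 i + (y 0 i - x 0 i)); last by lra.
rewrite (le_trans (ler_normD _ _))// normrM ger0_norm//; lra.
Qed.

End gaussian_box.

(** [K] stands for the Gaussian value, [A] for [aG], [Q] for the rescaled average kernel at
    [g_n(x)], [U] for the volume of the box, [v] for its density of conductance, and [a], [b] for
    the effect of enlarging and shrinking the box. The two product bounds say that [Q * v] is close
    to [K]. *)
Lemma limit_from_bounds (R : realType) (U K A B eps Q v a b k : R) :
  0 < U -> 0 <= K -> 0 < A -> 0 < eps <= 1 -> 0 <= Q -> Q <= B ->
  A - eps <= v -> v <= A + eps -> a <= 1 + eps -> 1 - eps <= b ->
  K - eps <= k -> 0 <= k ->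
  (Q - eps) * (v * U) <= (K + eps) * (U * a) + eps * U ->
  k * (U * b) - eps * U <= (Q + eps) * (v * U) ->
  `|K - Q * A| <= (A + K + B + 5) * eps.
Proof.
move=> U0 K0 A0 /andP[e0 e1] Q0 QB v1 v2 a1 b1 kK k0 up0 lo0.
have up : (Q - eps) * v <= (K + eps) * a + eps by rewrite -(ler_pM2r U0); lra.
have lo : k * b - eps <= (Q + eps) * v by rewrite -(ler_pM2r U0); lra.
have up' : (K + eps) * a <= (K + eps) * (1 + eps) by rewrite ler_pM2l//; lra.
have lo' : (K - eps) * (1 - eps) <= k * b.
  apply: (@le_trans _ _ (k * (1 - eps))); first by rewrite ler_wpM2r ?subr_ge0.
  by rewrite ler_wpM2l.
have Qv : `|Q * v - Q * A| <= B * eps.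
  rewrite -mulrBr normrM ger0_norm// ler_pM// ler_norml; lra.
have ee : eps * eps <= eps by rewrite ler_piMr// ltW.
have ee0 : 0 <= eps * eps by rewrite mulr_ge0// ltW.
have ev : eps * v <= eps * (A + 1) by rewrite ler_pM2l//; lra.
have eK : 0 <= eps * K by rewrite mulr_ge0// ltW.
move: Qv; rewrite !ler_norml => /andP[Qv1 Qv2].
by apply/andP; split; lra.
Qed.

(** * Closest vertices and rescaled boxes *)

Lemma seq_minimum (T : eqType) (e : rel T) (s : seq T) :
  total e -> transitive e -> s != [::] ->
  exists2 m, m \in s & forall w, w \in s -> e m w.
Proof.
move=> tot tr; elim: s => [//|a s IH] _.
have ee v : e v v by have := tot v v; rewrite orbb.
have [->|s0] := eqVneq s [::].
  by exists a; rewrite ?inE// => w; rewrite inE => /eqP ->.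
have [m ms minm] := IH s0; case/orP: (tot a m) => am.
  exists a; rewrite ?mem_head// => w; rewrite inE => /orP[/eqP ->//|/minm].
  exact: tr.
by exists m; rewrite ?inE ?ms ?orbT// => w; rewrite inE => /orP[/eqP ->|/minm].
Qed.

Section closest_vertex.
Context {R : realType} {d : nat} (G : lattice_subgraph d).
Implicit Types (x : 'rV[R]_d) (z : 'rV[int]_d) (r : R).

Lemma row_norm_le (v : 'rV[R]_d) r : 0 <= r ->
  `|v| <= r <-> forall i, `|v 0 i| <= r.
Proof.
move=> r0; have -> : `|v| = mx_norm v by [].
rewrite mx_normrE; split=> [/bigmax_leP[_ H] i|H].
  exact: (H (0, i)).
by apply/bigmax_leP; split=> // -[i j] _ /=; rewrite ord1.
Qed.

Lemma boxE x y r : 0 <= r -> box x r y <-> `|y - x| <= r.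
Proof.
move=> r0; rewrite row_norm_le//; split=> H i; have := H i.
  by rewrite !mxE ler_norml => /andP[? ?]; apply/andP; split; lra.
by rewrite !mxE ler_norml => /andP[? ?]; apply/andP; split; lra.
Qed.

Lemma scaled_box_verticesE n x r z : 0 <= r ->
  scaled_box_vertices G n x r z <->
  vertex G z /\ `|to_real z - Num.sqrt n%:R *: x| <= r * Num.sqrt n%:R.
Proof.
move=> r0; have rn : 0 <= r * Num.sqrt n%:R by rewrite mulr_ge0// sqrtr_ge0.
by split=> -[Vz zb]; split=> //; apply/boxE.
Qed.

Lemma scaled_box_vertices_sub n x r r' : r <= r' ->
  scaled_box_vertices G n x r `<=` scaled_box_vertices G n x r'.
Proof.
move=> rr z [Vz zb]; split=> // i; have := zb i.
have : r * Num.sqrt n%:R <= r' * Num.sqrt n%:R by rewrite ler_wpM2r ?sqrtr_ge0.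
by move=> ? /andP[? ?]; apply/andP; split; lra.
Qed.

(** Vertices outside of the box are farther than those inside, so a minimum of the distance over the
    finite box is global. All closest vertices lie in the box, and [tie] has a least element among
    them, so the default of [xget] is not reached. *)
Lemma gpoint_box (tie : rel 'rV[int]_d) n x r : total tie -> transitive tie ->
  0 <= r -> scaled_box_vertices G n x r !=set0 ->
  scaled_box_vertices G n x r (gpoint G tie n x).
Proof.
move=> tot tr r0 [z0 z0r].
pose A := scaled_box_vertices G n x r.
have finA : finite_set A by exact: finite_box_vertices.
pose dist z := `|to_real z - Num.sqrt n%:R *: x|.
have neA : (fset_set A : seq _) != [::].
  apply/eqP => s0; have : z0 \in (fset_set A : seq _).
    by rewrite in_fset_set//; exact/mem_set.
  by rewrite s0.
have [m0 m0A min0] : exists2 m, m \in (fset_set A : seq _) &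
    forall w, w \in (fset_set A : seq _) -> dist m <= dist w.
  apply: (@seq_minimum _ (fun u v => dist u <= dist v)) => //.
    by move=> u v; exact: le_total.
  by move=> u v w; exact: le_trans.
have Am0 : A m0 by move: m0A; rewrite in_fset_set// => /set_mem.
have cl0 : closest_vertex G n x m0.
  split; first by have [] := Am0.
  move=> w Vw; have [wA|wA] := lerP (dist w) (r * Num.sqrt n%:R).
    apply: min0; rewrite in_fset_set//; apply/mem_set.
    exact/scaled_box_verticesE.
  have [_ m0r] := (scaled_box_verticesE n x m0 r0).1 Am0.
  by rewrite (le_trans m0r)// ltW.
have clA z : closest_vertex G n x z -> A z.
  move=> [Vz /(_ m0)] zm; apply/scaled_box_verticesE => //; split=> //.
  have [Vm0 m0r] := (scaled_box_verticesE n x m0 r0).1 Am0.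
  exact: le_trans (zm Vm0) m0r.
pose B := closest_vertex G n x.
have finB : finite_set B by apply: sub_finite_set finA; exact: clA.
have neB : (fset_set B : seq _) != [::].
  apply/eqP => s0; have : m0 \in (fset_set B : seq _).
    by rewrite in_fset_set//; exact/mem_set.
  by rewrite s0.
have [b bB minb] := seq_minimum tot tr neB.
rewrite /gpoint; case: xgetP => [z _ [cz _]|]; first exact: clA.
move=> /(_ b) []; split.
  by move: bB; rewrite in_fset_set// => /set_mem.
by move=> w cw; apply: minb; rewrite in_fset_set//; exact/mem_set.
Qed.

End closest_vertex.

(** * Displacement of the chain in one step *)

Section increments.
Context {R : realType} {d : nat} (G : lattice_subgraph d).
Local Notation V := 'rV[int]_d.
Variables (mu : V -> V -> R) (CM : R).
Hypothesis G_infinite : infinite_set (vertex G).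
Hypothesis G_connected : connected_graph G.
Hypothesis mu_cond : conductances G mu CM.
Context {disp : measure_display} {Omega : measurableType disp}.
Variables (P : V -> probability Omega R) (X : nat -> Omega -> V).
Hypothesis X_chain : markov_chain G mu P X.
Implicit Types (v w x y z : V) (A B : set V).

Let mX n v : measurable (X n @^-1` [set v]).
Proof. exact: (chain_measurable X_chain). Qed.

(** Being in [A] at one time and outside of [B] at an adjacent time would require a jump between
    distinct vertices without an edge. Either time may come first, edges being symmetric. *)
Lemma chain_in_le x A B (k l : nat) : vertex G x -> finite_set A ->
  finite_set B -> k = l.+1 \/ l = k.+1 ->
  (forall y z, vertex G z -> A y -> ~ B z -> y != z /\ ~~ edge G y z) ->
  (P x (X k @^-1` A) <= P x (X l @^-1` B))%E.
Proof.
move=> Vx finA finB kl AB.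
have mA := measurable_chain_in X_chain k finA; have mB := measurable_chain_in X_chain l finB.
have far (n : nat) y z : vertex G y -> vertex G z -> y != z -> ~~ edge G y z ->
    P x (X n.+1 @^-1` [set y] `&` X n @^-1` [set z]) = 0%E.
  move=> Vy Vz yz eyz.
  rewrite (chain_one_step G_infinite G_connected mu_cond X_chain)//.
  rewrite (cond_sym mu_cond)// (cond_nonedge mu_cond)//; first by rewrite mul0r mule0.
pose E := X k @^-1` A `\` X l @^-1` B.
have mE : measurable E by exact: measurableD.
have E0 : P x E = 0%E.
  rewrite -(mule0 (P x E)).
  (* The event is null since it is null on the joint fibers of [X k] and [X l]. *)
  apply: (@measure_fibers_scale _ _ _ _ _ (X k)) => // y; rewrite mule0.
  rewrite -(mule0 (P x (E `&` X k @^-1` [set y]))).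
  apply: (@measure_fibers_scale _ _ _ _ _ (X l)) => //; try exact: measurableI.
  move=> z; rewrite mule0.
  have [[w [[[Aw Bw] /= Xy] Xz]]|] :=
      pselect (((E `&` X k @^-1` [set y]) `&` X l @^-1` [set z]) !=set0); last first.
    by move=> /set0P/negP/negPn/eqP ->; rewrite measure0.
  have Vy : vertex G y by rewrite -Xy; exact: (chain_vertex X_chain).
  have Vz : vertex G z by rewrite -Xz; exact: (chain_vertex X_chain).
  have [yz eyz] := AB y z Vz ltac:(by rewrite -Xy) ltac:(by rewrite -Xz).
  apply/eqP; rewrite eq_le measure_ge0 andbT.
  apply: (@le_trans _ _ (P x (X k @^-1` [set y] `&` X l @^-1` [set z]))).
    apply: le_measure.
    - by apply/mem_set; do 2 (apply: measurableI => //).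
    - by apply/mem_set; exact: measurableI.
    - by move=> u [[_ ?] ?].
  case: kl => kl; rewrite kl; first by rewrite far.
  rewrite setIC far// 1?eq_sym//; apply/negP => /(@edge_sym _ G).
  by apply/negP.
have kE : P x (X k @^-1` A) = (P x E + P x (X k @^-1` A `&` X l @^-1` B))%E.
  exact: measureDI.
rewrite kE E0 add0e; apply: le_measure; [|exact/mem_set|by move=> w []].
by apply/mem_set; exact: measurableI.
Qed.

Lemma edge_norm y z : edge G y z -> `|to_real y - to_real z : 'rV[R]_d| <= 1.
Proof.
move=> /(@edge_nearest _ G) yz; apply/row_norm_le => // i.
rewrite !mxE -intrB -intr_norm -[1]/(1%:~R) ler_int.
suff : `|y 0 i - z 0 i| <= \sum_(j < d) `|y 0 j - z 0 j| by rewrite yz.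
by rewrite (bigD1 i)//= lerDl sumr_ge0.
Qed.

Lemma chain_in_box_le x (u : 'rV[R]_d) (r r' : R) (n k l : nat) : vertex G x ->
  0 <= r -> 1 <= (r' - r) * Num.sqrt n%:R -> k = l.+1 \/ l = k.+1 ->
  (P x (X k @^-1` scaled_box_vertices G n u r) <=
   P x (X l @^-1` scaled_box_vertices G n u r'))%E.
Proof.
move=> Vx r0 rr kl; have rr' : r <= r'.
  rewrite leNgt; apply/negP => rr'; have := sqrtr_ge0 (n%:R : R); nra.
apply: chain_in_le => //; try exact: finite_box_vertices.
move=> y z Vz yr nzr.
suff far : 1 < `|to_real y - to_real z : 'rV[R]_d|.
  split; last by apply/negP => /edge_norm; rewrite leNgt far.
  by apply/eqP => yz; move: far; rewrite yz subrr normr0 ltr10.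
rewrite ltNge; apply/negP => yz; apply: nzr.
apply/scaled_box_verticesE; first exact: le_trans r0 _.
move/(scaled_box_verticesE G n u y r0) : yr => -[_ yr]; split=> //.
rewrite -[to_real z](subrK (to_real y)) -addrA (le_trans (ler_normD _ _))//.
rewrite distrC; move: rr yz yr; rewrite mulrBl; lra.
Qed.

Lemma rescaled_chain_box (u : 'rV[R]_d) (r s : R) (n : nat) : (0 < n)%N ->
  [set w | box u r (rescaled_chain X n s w)] =
  X (Num.truncn (n%:R * s)) @^-1` scaled_box_vertices G n u r.
Proof.
move=> n0; have sn : 0 < Num.sqrt n%:R :> R by rewrite sqrtr_gt0 ltr0n.
apply/seteqP; split=> w.
  move=> H; split; first exact: (chain_vertex X_chain).
  move=> i; have := H i; rewrite /rescaled_chain !mxE.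
  move=> /andP[]; rewrite ler_pdivlMl// ler_pdivrMl// => ? ?.
  by apply/andP; split; lra.
move=> [_ H] i; have := H i; rewrite /rescaled_chain !mxE => /andP[? ?].
by rewrite ler_pdivlMl// ler_pdivrMl//; apply/andP; split; lra.
Qed.

End increments.

(** * The local limit theorem *)

Section local_limit.
Context {R : realType} {d : nat} (G : lattice_subgraph d).
Local Notation V := 'rV[int]_d.
Variables (mu : V -> V -> R) (CM : R).
Hypothesis G_infinite : infinite_set (vertex G).
Hypothesis G_connected : connected_graph G.
Hypothesis G0 : vertex G 0.
Hypothesis mu_cond : conductances G mu CM.
Context {disp : measure_display} {Omega : measurableType disp}.
Variables (P : V -> probability Omega R) (X : nat -> Omega -> V).
Hypothesis X_chain : markov_chain G mu P X.
Variable tie : rel V.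
Hypotheses (tie_trans : transitive tie) (tie_total : total tie).
Variables (x : 'rV[R]_d) (t : R).
Hypothesis t_gt0 : 0 < t.
Variables (delta D CH C1 C2 C3 aG : R).
Hypotheses (delta_gt0 : 0 < delta) (CH_gt0 : 0 < CH) (C1_gt0 : 0 < C1)
  (C2_gt0 : 0 < C2) (aG_gt0 : 0 < aG).
Variable s : V -> R.
Hypothesis hb : forall (y : V) (k : nat), vertex G y -> C3 <= k%:R ->
  heat_kernel G mu P X k 0 y <= C2 * k%:R `^ (- (d%:R / 2)).
Hypothesis hc : forall (y : V) (r : R), vertex G y -> s y <= r ->
  PHI G mu CH y r (r ^+ 2).
Hypothesis hd : forall r : R, 0 < r ->
  (fun n => cond_measure G mu (scaled_box_vertices G n x r) /
            (2 * Num.sqrt n%:R * r) ^+ d) @ \oo --> aG.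
Hypothesis he : forall r : R, 0 < r -> exists n0 : nat, forall n, (n0 <= n)%N ->
  forall x' y' : V,
    scaled_box_vertices G n x r x' -> scaled_box_vertices G n x r y' ->
    `|to_real x' - to_real y'| <= (gdist G x' y')%:R :> R /\
    (gdist G x' y')%:R <=
      Num.max (C1 * `|to_real x' - to_real y'|) (n%:R `^ (1 / 2 - delta)).
Hypothesis hf :
  (fun n => (Num.sqrt n%:R)^-1 * s (gpoint G tie n x)) @ \oo --> 0.

Local Notation p k z := (heat_kernel G mu P X k 0 z).
Local Notation sq n := (Num.sqrt (n%:R : R)).
Local Notation Lam r n := (scaled_box_vertices G n x r).
Local Notation g n := (gpoint G tie n x).

Lemma natr_powR_half n : n%:R `^ (d%:R / 2) = sq n ^+ d.
Proof.
by rewrite mulrC powRrM powR12_sqrt// powR_mulrn// sqrtr_ge0.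
Qed.

Lemma near_sqrt (c : R) : \forall n \near \oo, c <= sq n.
Proof.
near=> n; have [c0|c0] := lerP c 0; first exact: le_trans c0 (sqrtr_ge0 _).
rewrite -[c](ger0_norm (ltW c0)) -sqrtr_sqr ler_sqrt//.
by near: n; exact: nbhs_infty_ger.
Unshelve. all: by end_near. Qed.

Lemma near_sqrt_gt0 : \forall n \near \oo, 0 < sq n.
Proof.
by apply: filterS (near_sqrt 1) => n; exact: lt_le_trans.
Qed.

Lemma near_natr (c : R) : \forall n \near \oo, c <= n%:R.
Proof. exact: nbhs_infty_ger. Qed.

Lemma heat_kernel_upper (c : R) : 0 < c -> \forall n \near \oo,
  forall k z, vertex G z -> c * n%:R <= k%:R ->
  p k z * sq n ^+ d <= C2 / Num.sqrt c ^+ d.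
Proof.
move=> c0; near=> n; move=> k z Vz nk.
have sn0 : 0 < sq n by near: n; exact: near_sqrt_gt0.
have C3k : C3 <= k%:R.
  apply: le_trans nk; rewrite -ler_pdivrMl//; near: n; exact: near_natr.
have sc0 : 0 < Num.sqrt c by rewrite sqrtr_gt0.
have sk : Num.sqrt c * sq n <= sq k by rewrite -sqrtrM ?(ltW c0)// ler_sqrt.
have skd : (Num.sqrt c * sq n) ^+ d <= sq k ^+ d.
  by rewrite lerXn2r// nnegrE ?mulr_ge0 ?sqrtr_ge0.
have := hb Vz C3k; rewrite powRN natr_powR_half => pk.
have scn : 0 < (Num.sqrt c * sq n) ^+ d by rewrite exprn_gt0// mulr_gt0.
rewrite ler_pdivlMr ?exprn_gt0// -mulrA [X in _ * X]mulrC -exprMn.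
apply: (@le_trans _ _ (C2 / (sq k ^+ d) * (Num.sqrt c * sq n) ^+ d)).
  by rewrite ler_wpM2r// ltW.
rewrite -mulrA ler_piMr ?(ltW C2_gt0)//.
by rewrite ler_pdivrMl ?mulr1// (lt_le_trans scn).
Unshelve. all: by end_near. Qed.

Lemma near_volume (r : R) : 0 < r -> \forall n \near \oo,
  aG / 2 * (2 * r) ^+ d * sq n ^+ d <= cond_measure G mu (Lam r n).
Proof.
move=> r0; have aG2 : aG / 2 < aG by have := aG_gt0; lra.
near=> n; have sn0 : 0 < sq n by near: n; exact: near_sqrt_gt0.
have : aG / 2 <= cond_measure G mu (Lam r n) / (2 * sq n * r) ^+ d.
  by near: n; exact: (cvgr_ge aG (hd r0)).
rewrite ler_pdivlMr ?exprn_gt0 ?mulr_gt0//.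
by rewrite (mulrAC 2) [X in _ * X <= _]exprMn mulrA.
Unshelve. all: by end_near. Qed.

(** By [hd] the box eventually has positive conductance measure, so it contains a vertex. *)
Lemma near_gpoint (r : R) : 0 < r -> \forall n \near \oo, Lam r n (g n).
Proof.
move=> r0; near=> n; apply: gpoint_box => //; first exact: ltW.
have sn0 : 0 < sq n by near: n; exact: near_sqrt_gt0.
have : aG / 2 * (2 * r) ^+ d * sq n ^+ d <= cond_measure G mu (Lam r n).
  by near: n; exact: near_volume.
apply: contraPP => /set0P/negP/negPn/eqP ->.
rewrite /cond_measure fsbig_set0 leNgt => /negP; apply.
by rewrite !mulr_gt0 ?divr_gt0 ?exprn_gt0// mulr_gt0.
Unshelve. all: by end_near. Qed.

Lemma near_gpoint_vertex : \forall n \near \oo, vertex G (g n).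
Proof. by apply: filterS (near_gpoint ltr01) => n []. Qed.

(** Two points of the box are within [2 * r * sq n] in the sup norm; [he] turns this into a graph
    distance, and the power [1 / 2 - delta] is negligible before [sq n]. *)
Lemma near_ball (r c : R) : 0 < r -> 2 * C1 * r < c -> \forall n \near \oo,
  Lam r n `<=` gball G (g n) (c * sq n).
Proof.
move=> r0 rc; have c0 : 0 < c by apply: lt_trans rc; rewrite !mulr_gt0.
have [n0 n0P] := he r0.
near=> n; move=> z zr.
have sn0 : 0 < sq n by near: n; exact: near_sqrt_gt0.
have yr : Lam r n (g n) by near: n; exact: near_gpoint.
have n0n : (n0 <= n)%N by near: n; exact: nbhs_infty_ge.
split; first by have [] := zr.
have [_] := n0P n n0n _ _ yr zr; move=> /le_lt_trans; apply.
rewrite gt_max; apply/andP; split.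
  have [_ z1] := (scaled_box_verticesE G n x z (ltW r0)).1 zr.
  have [_ y1] := (scaled_box_verticesE G n x (g n) (ltW r0)).1 yr.
  have : `|to_real (g n) - to_real z : 'rV[R]_d| <= 2 * r * sq n.
    rewrite -[to_real (g n)](subrK (sq n *: x)) -addrA (le_trans (ler_normD _ _))//.
    by rewrite [X in _ + X]distrC; lra.
  move=> yz; apply: (@le_lt_trans _ _ (C1 * (2 * r * sq n))); first by rewrite ler_pM2l.
  by rewrite !mulrA ltr_pM2r// (mulrC C1).
have n1 : 0 < n%:R :> R by rewrite -sqrtr_gt0.
have -> : 1 / 2 - delta = 2^-1 + - delta by lra.
rewrite powRD; last by rewrite (gt_eqF n1) implybT.
rewrite powR12_sqrt ?(ltW n1)// mulrC ltr_pM2r// powRN.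
rewrite -[c]invrK ltf_pV2 ?posrE ?powR_gt0 ?invr_gt0//.
(* In this form [n ^ (- delta) < c] reduces to [n] exceeding a constant. *)
have -> : c^-1 = (c^-1 `^ delta^-1) `^ delta.
  by rewrite -powRrM mulVf ?gt_eqF// powRr1// invr_ge0 ltW.
rewrite gt0_ltr_powR ?nnegrE ?powR_ge0//.
apply: (@lt_le_trans _ _ (c^-1 `^ delta^-1 + 1)); first by rewrite ltrDl.
by near: n; exact: near_natr.
Unshelve. all: by end_near. Qed.

Lemma near_PHI (c : R) : 0 < c -> \forall n \near \oo,
  forall r, c * sq n <= r -> PHI G mu CH (g n) r (r ^+ 2).
Proof.
move=> c0; near=> n; move=> r cr.
have sn0 : 0 < sq n by near: n; exact: near_sqrt_gt0.
apply: hc; first by near: n; exact: near_gpoint_vertex.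
apply: le_trans cr; rewrite mulrC -ler_pdivrMl//.
by near: n; apply: (cvgr_le 0 hf).
Unshelve. all: by end_near. Qed.

Lemma near_diag (rho : R) : 0 < rho -> exists2 C, 0 < C &
  \forall n \near \oo, forall m z, gball G (g n) (rho * sq n / 2) z ->
    (rho * sq n) ^+ 2 / 4 <= m%:R <= (rho * sq n) ^+ 2 / 2 ->
    heat_kernel G mu P X m z z * sq n ^+ d <= C.
Proof.
(* Then [2 * C1 * r = rho / 4], so [near_ball] puts the box inside the half ball on which Harnack
   compares values, and [near_volume] bounds its measure below. *)
move=> rho0; pose r := rho / (8 * C1).
have r0 : 0 < r by rewrite divr_gt0// mulr_gt0.
have rC : 2 * C1 * r < rho / 2.
  have -> : 2 * C1 * r = rho / 4 by rewrite /r; field; rewrite gt_eqF.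
  lra.
pose v := aG / 2 * (2 * r) ^+ d.
have v0 : 0 < v by rewrite mulr_gt0 ?divr_gt0// exprn_gt0// mulr_gt0.
exists (2 * CH / v); first by rewrite divr_gt0// mulr_gt0.
near=> n; move=> m z zr mr.
have sn0 : 0 < sq n by near: n; exact: near_sqrt_gt0.
have r4 : 4 <= rho * sq n.
  by rewrite -ler_pdivrMl//; near: n; exact: near_sqrt.
have phi : PHI G mu CH (g n) (rho * sq n) ((rho * sq n) ^+ 2).
  have H : forall r, rho * sq n <= r -> PHI G mu CH (g n) r (r ^+ 2).
    by near: n; exact: near_PHI.
  exact: H.
have Vg : vertex G (g n) by near: n; exact: near_gpoint_vertex.
have sub : Lam r n `<=` gball G (g n) (rho * sq n / 2).
  by rewrite mulrAC; near: n; exact: near_ball.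
have := heat_kernel_diag_le G_infinite G_connected mu_cond X_chain CH_gt0 Vg r4
  phi (@finite_box_vertices _ _ G _ _) sub zr mr.
have vol : v * sq n ^+ d <= cond_measure G mu (Lam r n).
  by near: n; exact: near_volume.
rewrite ler_pdivlMr//; apply: le_trans; rewrite -mulrA (mulrC (sq n ^+ d)).
have [Vz _] := zr; apply: ler_wpM2l => //.
exact: (heat_kernel_ge0 G_infinite G_connected mu_cond).
Unshelve. all: by end_near. Qed.

Lemma near_time_regularity (rho : R) : 0 < rho -> rho ^+ 2 <= t / 2 ->
  exists2 C, 0 < C & \forall n \near \oo, forall k z,
    gball G (g n) (rho * sq n / 2) z -> t / 2 * n%:R <= k%:R ->
    `|p k.+2 z - p k z| * sq n ^+ d <= C / n%:R.
Proof.
move=> rho0 rhot; have [C C0 diag] := near_diag rho0.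
have t0 := t_gt0.
have t16 : 0 < t / 16 by lra.
pose B := C2 / Num.sqrt (t / 16) ^+ d.
have B0 : 0 < B by rewrite divr_gt0// exprn_gt0// sqrtr_gt0.
have rho20 : 0 < rho ^+ 2 by rewrite exprn_gt0.
have p512 : 0 < 512 :> R by rewrite ltr0n.
have B512 : 0 < B * 512 / t ^+ 2.
  exact: divr_gt0 (mulr_gt0 B0 p512) (exprn_gt0 2 t0).
(* With [lam = n] and [h >= t n / 32], the factor [1 / (2 h^2)] is at most [512 / (t n)^2]. *)
exists (B * 512 / t ^+ 2 + C); first exact: addr_gt0.
near=> n; move=> k z zr kn.
have sn0 : 0 < sq n by near: n; exact: near_sqrt_gt0.
have n0 : 0 < n%:R :> R by rewrite -sqrtr_gt0.
have sn2 : sq n ^+ 2 = n%:R by rewrite sqr_sqrtr// ltW.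
have [Vz _] := zr.
have rn : (rho * sq n) ^+ 2 = rho ^+ 2 * n%:R by rewrite exprMn sn2.
have big1 : 32 / t <= n%:R by near: n; exact: near_natr.
have big2 : 8 / rho ^+ 2 <= n%:R by near: n; exact: near_natr.
have tn32 : 32 <= t * n%:R by move: big1; rewrite ler_pdivrMr// mulrC.
have rn8 : 8 <= rho ^+ 2 * n%:R by move: big2; rewrite ler_pdivrMr// mulrC.
have rtn : rho ^+ 2 * n%:R <= t / 2 * n%:R by rewrite ler_wpM2r// ltW.
(* [2m] falls in the time range of [near_diag], and [k - m] remains at least [4h] for [h] close to
   [t n / 16]. *)
pose m := (Num.truncn (rho ^+ 2 * n%:R / 8)).+1.
have [m1 m2] : rho ^+ 2 * n%:R / 8 <= m%:R /\ m%:R <= rho ^+ 2 * n%:R / 8 + 1.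
  split; first by rewrite ltW// truncnS_gt.
  by rewrite /m -[_.+1%:R]natr1 lerD2r truncn_le//; lra.
clearbody m.
pose h := Num.truncn (t * n%:R / 16).
have [h1 h2] : h%:R <= t * n%:R / 16 /\ t * n%:R / 16 < h%:R + 1.
  split; first by rewrite truncn_le//; lra.
  by rewrite natr1 truncnS_gt.
clearbody h.
have mk : (m <= k)%N by rewrite -(ler_nat R); lra.
pose a := (k - m)%N; have kam : (k = a + m)%N by rewrite subnK.
clearbody a; subst k.
have aR : (a + m)%:R = a%:R + m%:R :> R by rewrite natrD.
have ha : (4 * h <= a)%N by rewrite -(ler_nat R) natrM; lra.
have hbig : t * n%:R / 32 <= h%:R by lra.
have h0 : 0 < h%:R :> R by lra.
have hN : (0 < h)%N by rewrite -(ltr_nat R).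
have := heat_kernel_time_regularity G_infinite G_connected mu_cond X_chain
  m G0 Vz n0 hN ha.
have phh : p (h + h) 0 * sq n ^+ d <= B.
  have H : forall k z, vertex G z -> t / 16 * n%:R <= k%:R ->
    p k z * sq n ^+ d <= C2 / Num.sqrt (t / 16) ^+ d.
    by near: n; exact: heat_kernel_upper.
  by apply: H => //; rewrite natrD; lra.
have pmm : heat_kernel G mu P X (m + m) z z * sq n ^+ d <= C.
  have H : forall m z, gball G (g n) (rho * sq n / 2) z ->
    (rho * sq n) ^+ 2 / 4 <= m%:R <= (rho * sq n) ^+ 2 / 2 ->
    heat_kernel G mu P X m z z * sq n ^+ d <= C by near: n.
  by apply: H => //; rewrite rn natrD; apply/andP; split; lra.
have Sd0 : 0 < sq n ^+ d by rewrite exprn_gt0.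
move: phh pmm; move: (p (h + h) 0) (heat_kernel _ _ _ _ _ z z) (`|_|) (sq n ^+ d) Sd0.
move=> ph pm A S S0 phh pmm Ale.
have A0 : 2 * (A * S) <= n%:R * (B / (2 * h%:R ^+ 2)) + n%:R^-1 * C.
  rewrite mulrA; apply: (@le_trans _ _ ((n%:R * (ph / (2 * h%:R ^+ 2)) + n%:R^-1 * pm) * S)).
    by rewrite ler_pM2r.
  rewrite mulrDl lerD//.
    by rewrite -mulrA ler_pM2l// mulrAC ler_pM2r// invr_gt0 mulr_gt0// exprn_gt0.
  by rewrite -mulrA ler_pM2l// invr_gt0.
have h2n : n%:R * (B / (2 * h%:R ^+ 2)) <= B * 512 / t ^+ 2 / n%:R.
  have -> : B * 512 / t ^+ 2 / n%:R = n%:R * (B / (2 * (t * n%:R / 32) ^+ 2)).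
    by field; rewrite !gt_eqF.
  have tn0 : 0 < t * n%:R / 32 by lra.
  rewrite ler_pM2l// ler_pM2l// lef_pV2 ?posrE ?mulr_gt0 ?exprn_gt0//.
  rewrite ler_pM2l// lerXn2r ?nnegrE//; exact: ltW.
have Cn0 : 0 < n%:R^-1 * C by rewrite mulr_gt0// invr_gt0.
have Bn0 : 0 < B * 512 / t ^+ 2 / n%:R by exact: divr_gt0.
rewrite mulrDl (mulrC C); move: A0 h2n Cn0 Bn0.
by move: (B * _ / _ / _) (_^-1 * C) (n%:R * _) => u v w; lra.
Unshelve. all: by end_near. Qed.

(** Half of [heat_kernel_hat] at time [n t]. The average is indexed by the later of its two times,
    hence the successor. *)
Local Notation q n z :=
  (avg (fun k => heat_kernel G mu P X k 0) (Num.truncn (n%:R * t)).+1 z).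

Lemma near_oscillation (eps : R) : 0 < eps -> exists2 r0, 0 < r0 &
  \forall n \near \oo, forall z, Lam r0 n z ->
    `|q n z - q n (g n)| * sq n ^+ d <= eps.
Proof.
move=> eps0; have t0 := t_gt0.
pose rho := Num.sqrt (t / 2).
have rho0 : 0 < rho by rewrite sqrtr_gt0; lra.
have rho2 : rho ^+ 2 = t / 2 by rewrite sqr_sqrtr//; lra.
have rho2le : rho ^+ 2 <= t / 2 by rewrite rho2.
have [C C0 reg] := near_time_regularity rho0 rho2le.
have th0 : 0 < t / 2 by lra.
pose B := C2 / Num.sqrt (t / 2) ^+ d.
have B0 : 0 < B by rewrite divr_gt0// exprn_gt0// sqrtr_gt0.
have CH0 := CH_gt0.
pose ga := 1 - (CH + 1)^-1.
have ga01 : 0 <= ga < 1.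
  have i1 : (CH + 1)^-1 <= 1 by rewrite invf_le1; lra.
  have i0 : 0 < (CH + 1)^-1 by rewrite invr_gt0; lra.
  by rewrite /ga; apply/andP; split; lra.
(* One half of [eps] is for the oscillation left after [J.+1] steps, the other for the return from
   the iterated average to [avg]. *)
have [J gaJ] : exists J : nat, B * ga ^+ J.+1 <= eps / 2.
  have /andP[g0 g1] := ga01.
  have : geometric B ga @ \oo --> 0 by apply: cvg_geometric; rewrite ger0_norm.
  have e2 : 0 < eps / 2 by lra.
  move=> /cvgr_le/(_ _ e2)[J _ HJ]; exists J.
  by apply: HJ => /=.
pose c := 2 * (rho / 4 ^+ J.+1).
have e4 k : 0 < (4 : R) ^+ k by rewrite exprn_gt0.
have c0 : 0 < c by rewrite mulr_gt0// divr_gt0.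
pose r0 := c / (4 * C1).
have r00 : 0 < r0 by rewrite divr_gt0// mulr_gt0.
have rc : 2 * C1 * r0 < c.
  have -> : 2 * C1 * r0 = c / 2 by rewrite /r0; field; rewrite gt_eqF.
  lra.
exists r0 => //; near=> n; move=> z zr.
have sn0 : 0 < sq n by near: n; exact: near_sqrt_gt0.
have n0 : 0 < n%:R :> R by rewrite -sqrtr_gt0.
have sn2 : sq n ^+ 2 = n%:R by rewrite sqr_sqrtr// ltW.
have Vg : vertex G (g n) by near: n; exact: near_gpoint_vertex.
have zb : gball G (g n) (c * sq n) z.
  have H : Lam r0 n `<=` gball G (g n) (c * sq n) by near: n; exact: near_ball.
  exact: H.
have gb : gball G (g n) (c * sq n) (g n).
  by split=> //; rewrite gdistxx mulr_gt0.
pose M := (Num.truncn (n%:R * t)).+1.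
have Mn : t * n%:R <= M%:R by rewrite mulrC ltW// truncnS_gt.
pose f k := heat_kernel G mu P X k 0.
have S0 : 0 < sq n ^+ d by rewrite exprn_gt0.
have bigJ : (2 * J.+3%:R) / t <= n%:R by near: n; exact: near_natr.
have tJ : 2 * J.+3%:R <= t * n%:R by move: bigJ; rewrite ler_pdivrMr// [_ * t]mulrC.
have rn2 : (rho * sq n) ^+ 2 = t / 2 * n%:R by rewrite exprMn sn2 rho2.
have J3 : J.+3%:R = J.+1%:R + 2 :> R by rewrite -addn2 natrD.
have upper : forall k z, vertex G z -> t / 2 * n%:R <= k%:R ->
    f k z * sq n ^+ d <= B by near: n; exact: heat_kernel_upper.
have osc : exists lo, forall k z, M%:R - (rho * sq n / 4 ^+ J.+1) ^+ 2 <= k%:R ->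
    (k <= M)%N -> gball G (g n) (2 * (rho * sq n / 4 ^+ J.+1)) z ->
    lo <= iter J.+1 (@avg R V) f k z <= lo + B / sq n ^+ d * ga ^+ J.+1.
  apply: (oscillation_iter G_connected mu_cond CH_gt0 Vg).
  - exact: (caloric_heat_kernel G_infinite G_connected mu_cond X_chain G0).
  - rewrite rn2; lra.
  - by rewrite mulr_ge0 ?ltW.
  (* All the radii are at least the last one, so a single instance of [near_PHI] covers them. *)
  - move=> j jJ; have le4 : rho * sq n / 4 ^+ J.+1 <= rho * sq n / 4 ^+ j.
      rewrite ler_pM2l ?mulr_gt0// lef_pV2 ?posrE//.
      by rewrite ler_weXn2l// ?ler1n// ltnW.
    split.
      apply: le_trans le4; rewrite mulrAC -ler_pdivrMl ?divr_gt0//.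
      by near: n; exact: near_sqrt.
    have H : forall r, rho / 4 ^+ J.+1 * sq n <= r -> PHI G mu CH (g n) r (r ^+ 2).
      by near: n; apply: near_PHI; rewrite divr_gt0.
    by apply: H; rewrite mulrAC.
  (* The initial oscillation comes from the upper bound on the kernel, the whole time window being
     after [t n / 2]. *)
  - exists 0 => k w kM _ [Vw _]; rewrite add0r; apply/andP; split.
      exact: (heat_kernel_ge0 G_infinite G_connected mu_cond).
    by rewrite ler_pdivlMr//; apply: upper => //; rewrite -rn2; lra.
have [lo {}osc] := osc.
have cE : c * sq n = 2 * (rho * sq n / 4 ^+ J.+1) by rewrite /c; field; rewrite gt_eqF.
rewrite cE in zb gb.
have Mr : M%:R - (rho * sq n / 4 ^+ J.+1) ^+ 2 <= M%:R.
  by rewrite lerBlDr lerDl sqr_ge0.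
have regn : forall k z, gball G (g n) (rho * sq n / 2) z -> t / 2 * n%:R <= k%:R ->
    `|f k.+2 z - f k z| * sq n ^+ d <= C / n%:R by near: n.
(* The iterate consists of [J] averages of [avg f], whose increments are half of the two-step
   differences of [f]. *)
have close w : gball G (g n) (2 * (rho * sq n / 4 ^+ J.+1)) w ->
    `|iter J.+1 (@avg R V) f M w - avg f M w| <= J%:R * (C / n%:R / sq n ^+ d / 2).
  move=> [Vw wb]; rewrite iterSr.
  have wb' : gball G (g n) (rho * sq n / 2) w.
    split=> //; apply: lt_le_trans wb _.
    rewrite mulrCA ler_pM2l ?mulr_gt0// exprS invfM.
    have : ((4 : R) ^+ J)^-1 <= 1 by rewrite invf_le1// exprn_ege1// ler1n.
    lra.
  have JM : (J.+2 <= M)%N 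
    by rewrite -(ler_nat R) -[J.+2%:R]natr1; have := ler0n R J.+1; lra.
  have [||_] := @avg_iter_close R V (avg f) w (C / n%:R / sq n ^+ d / 2) (M - J.+1) M J _ M.
  - move=> k kM; have [i ki] : exists i, (k = i.+2)%N.
      by exists k.-2; move: kM JM; clear; lia.
    rewrite ki /avg/= in kM *.
    have -> : (f i.+2 w + f i.+1 w) / 2 - (f i.+1 w + f i w) / 2 =
      (f i.+2 w - f i w) / 2 by field.
    rewrite normrM (ger0_norm (_ : 0 <= 2^-1))// ler_pM2r//.
    rewrite ler_pdivlMr//; apply: regn => //.
    have : (M <= i + J.+3)%N by move: kM JM; clear; lia.
    by rewrite -(ler_nat R) natrD; lra.
  - by move: JM; clear; lia.
  - by [].
have bJ : J%:R * C / (eps / 2) <= n%:R by near: n; exact: near_natr.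
have Je : J%:R * (C / n%:R) <= eps / 2.
  have e2 : 0 < eps / 2 by rewrite divr_gt0.
  by rewrite mulrA ler_pdivrMr// [_ * n%:R]mulrC -ler_pdivrMr.
have /andP[z1 z2] := osc M z Mr (leqnn M) zb.
have /andP[g1 g2] := osc M (g n) Mr (leqnn M) gb.
move: (close _ zb) (close _ gb); rewrite -/M -/f.
rewrite !ler_distl => /andP[z3 z4] /andP[g3 g4].
rewrite -ler_pdivlMr//.
have E1 : J%:R * (C / n%:R / sq n ^+ d / 2) = J%:R * (C / n%:R) / sq n ^+ d / 2.
  by rewrite !mulrA.
have E2 : J%:R * (C / n%:R) / sq n ^+ d <= eps / 2 / sq n ^+ d.
  by rewrite ler_pM2r// invr_gt0.
have E3 : B / sq n ^+ d * ga ^+ J.+1 <= eps / 2 / sq n ^+ d.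
  by rewrite mulrAC ler_pM2r// invr_gt0.
have E4 : eps / sq n ^+ d = eps / 2 / sq n ^+ d + eps / 2 / sq n ^+ d.
  by rewrite -mulrDl -splitr.
rewrite E1 in z3 z4 g3 g4; rewrite E4 ler_norml.
move: (eps / 2 / _) (B / _ * _) (J%:R * _ / _) E2 E3 z1 z2 g1 g2 z3 z4 g3 g4.
by move=> e b j *; apply/andP; split; lra.
Unshelve. all: by end_near. Qed.

Hypothesis ha : forall (u : R) (y : 'rV[R]_d) (r : R), 0 < u -> 0 < r ->
  (fun n => P 0 [set w | box y r (rescaled_chain X n u w)]) @ \oo -->
  lebesgue_integral_Rd (box y r) (gauss_kernel D u).

Local Notation mass r n := (fine (P 0 (X (Num.truncn (n%:R * t)) @^-1` Lam r n))).

Lemma sum_average (r : R) n :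
  2 * \sum_(z \in Lam r n) cond_vertex G mu z * q n z =
  fine (P 0 (X (Num.truncn (n%:R * t)).+1 @^-1` Lam r n)) + mass r n.
Proof.
have finL : finite_set (Lam r n) by exact: finite_box_vertices.
have LV : Lam r n `<=` vertex G by move=> z [].
rewrite !(heat_kernel_sum G_infinite G_connected mu_cond X_chain)//=.
rewrite mulr_fsumr -fsbig_split//; apply: eq_fsbigr => z _.
by rewrite /avg/=; field.
Qed.

Let mass_le (r r' : R) (n k l : nat) : 0 <= r -> 1 <= (r' - r) * sq n ->
  k = l.+1 \/ l = k.+1 ->
  fine (P 0 (X k @^-1` Lam r n)) <= fine (P 0 (X l @^-1` Lam r' n)).
Proof.
move=> r0 rr kl; rewrite fine_le//.
- apply: fin_num_measure; apply: (measurable_chain_in X_chain).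
  exact: finite_box_vertices.
- apply: fin_num_measure; apply: (measurable_chain_in X_chain).
  exact: finite_box_vertices.
- exact: (chain_in_box_le G_infinite G_connected mu_cond X_chain).
Qed.

Let mass_mono (r r' : R) (n k : nat) : r <= r' ->
  fine (P 0 (X k @^-1` Lam r n)) <= fine (P 0 (X k @^-1` Lam r' n)).
Proof.
move=> rr.
have mL c : measurable (X k @^-1` Lam c n).
  by apply: (measurable_chain_in X_chain); exact: finite_box_vertices.
rewrite fine_le ?fin_num_measure// le_measure ?mem_set//.
by move=> w; exact: scaled_box_vertices_sub.
Qed.

(** [ha] concerns the time [Num.truncn (n%:R * t)] only; its successor is replaced by it at the cost
    of a slightly larger box, since one step is short compared with [sq n]. *)
Lemma near_mass (r r' : R) : 0 <= r -> r < r' -> \forall n \near \oo,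
  \sum_(z \in Lam r n) cond_vertex G mu z * q n z <= mass r' n /\
  mass r n <= \sum_(z \in Lam r' n) cond_vertex G mu z * q n z.
Proof.
move=> r0 rr; have rr0 : 0 < r' - r by rewrite subr_gt0.
near=> n; have rn : 1 <= (r' - r) * sq n.
  by rewrite -ler_pdivrMl// mulr1; near: n; exact: near_sqrt.
have := sum_average r n; have := sum_average r' n.
have := mass_mono n (Num.truncn (n%:R * t)) (ltW rr).
have := mass_le r0 rn (or_introl (erefl (Num.truncn (n%:R * t)).+1)).
have := mass_le r0 rn (or_intror (erefl (Num.truncn (n%:R * t)).+1)).
move: (mass r n) (mass r' n) (fine _) (fine _) (\sum_(_ \in _) _) (\sum_(_ \in _) _).
by move=> *; split; lra.
Unshelve. all: by end_near. Qed.

Lemma near_gauss_mass (r lo hi e : R) : 0 < r -> 0 <= lo -> 0 < e ->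
  (forall y, box x r y -> lo <= gauss_kernel D t y <= hi) ->
  \forall n \near \oo,
    lo * (2 * r) ^+ d - e <= mass r n <= hi * (2 * r) ^+ d + e.
Proof.
move=> r0 lo0 e0 bnd; have := lebesgue_integral_box_bounds r0 lo0 bnd.
have := @ha t x r t_gt0 r0.
(* The two bounds exclude infinite values of the integral. *)
move: (lebesgue_integral_Rd _ _) => [I||] cI; [|by rewrite leye_eq andbF|by rewrite leeNy_eq].
rewrite !lee_fin => /andP[I1 I2].
have near1 := (cvgrPdist_le _ _).1 (fine_cvg cI) e e0.
near=> n.
have n0 : (0 < n)%N by near: n; exact: nbhs_infty_gt.
have : `|I - fine (P 0 [set w | box x r (rescaled_chain X n t w)])| <= e.
  by near: n; exact: near1.
rewrite (rescaled_chain_box X_chain)// ler_distl => /andP[? ?].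
by apply/andP; split; lra.
Unshelve. all: by end_near. Qed.

(** Bernoulli's inequality bounds [(1 - th) ^+ d] below by [1 - eps / 2], and its product with
    [(1 + th) ^+ d] is at most 1. *)
Lemma power_near_one (eps : R) : 0 < eps <= 1 ->
  exists2 th, 0 < th < 1 & 1 - eps <= (1 - th) ^+ d /\ (1 + th) ^+ d <= 1 + eps.
Proof.
move=> /andP[e0 e1]; pose th := eps / 2 / d.+1%:R.
have d1 : 1 <= d.+1%:R :> R by rewrite ler1n.
have th0 : 0 < th by rewrite !divr_gt0.
have thd : d%:R * th <= eps / 2.
  rewrite /th mulrCA ler_piMr ?divr_ge0//; first exact: ltW.
  by rewrite ler_pdivrMr// mul1r ler_nat.
have th1 : th <= eps / 2 by rewrite /th ler_pdivrMr// ler_peMr// ltW// divr_gt0.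
have bern (k : nat) : 1 - k%:R * th <= (1 - th) ^+ k.
  elim: k => [|k IH]; first by rewrite mul0r subr0 expr0.
  rewrite exprS -natr1; apply: (@le_trans _ _ ((1 - th) * (1 - k%:R * th))).
    have : 0 <= th * (k%:R * th) by rewrite !mulr_ge0// ltW.
    lra.
  by rewrite ler_wpM2l//; lra.
have low := bern d; clearbody th.
exists th; first by apply/andP; split; lra.
split; first by lra.
have pos : 0 < (1 - th) ^+ d by rewrite exprn_gt0//; lra.
have prod1 : (1 + th) ^+ d * (1 - th) ^+ d <= 1.
  by rewrite -exprMn exprn_ile1//; nra.
have := exprn_ge0 d (_ : 0 <= 1 + th); move=> /(_ ltac:(lra)).
move: ((1 + th) ^+ d) ((1 - th) ^+ d) low pos prod1 => a b low pos prod1 a0.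
have b1 : 1 - eps / 2 <= b by lra.
have ab : a * (1 - eps / 2) <= 1 by apply: le_trans prod1; rewrite ler_wpM2l.
rewrite -(ler_pM2r (_ : 0 < 1 - eps / 2)); last lra.
by apply: le_trans ab _; nra.
Qed.

(** By the oscillation bound, the sum of [q] over a small box is its conductance measure times the
    value at [g_n(x)]; it also lies between the masses of a smaller and a larger box, which the
    central limit theorem evaluates. *)
Lemma near_limit : exists2 C, 0 < C & forall eps, 0 < eps <= 1 ->
  \forall n \near \oo,
    `|gauss_kernel D t x - q n (g n) * sq n ^+ d * aG| <= C * eps.
Proof.
have t0 := t_gt0; have aG0 := aG_gt0.
set K := gauss_kernel D t x.
have K0 : 0 <= K by rewrite mulr_ge0 ?powR_ge0 ?expR_ge0.
pose B := C2 / Num.sqrt (t / 2) ^+ d.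
have th0 : 0 < t / 2 by lra.
have B0 : 0 < B by rewrite divr_gt0// exprn_gt0// sqrtr_gt0.
exists (aG + K + B + 5); first by lra.
move=> eps eps01; have /andP[eps0 eps1] := eps01.
have [th /andP[th_gt0 th1] [thlo thhi]] := power_near_one eps01.
have [rk rk0 contK] := gauss_kernel_continuous D t x eps0.
have [ro ro0 osc] := near_oscillation eps0.
(* Below [ro] for the oscillation, and below [rk / 2] so that the enlarged box still lies where the
   kernel is nearly constant. *)
pose r := Num.min ro (rk / 2).
have r0 : 0 < r by rewrite lt_min ro0 divr_gt0.
have [rro rrk] : r <= ro /\ r <= rk / 2.
  by split; rewrite /r ge_min lexx ?orbT.
clearbody r.
have rd0 : 0 < (2 * r) ^+ d by rewrite exprn_gt0// mulr_gt0.
(* The maximum with 0 provides the nonnegative lower bound that [near_gauss_mass] requires. *)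
have bnd r' : 0 < r' -> r' <= rk -> forall y, box x r' y ->
    Num.max 0 (K - eps) <= gauss_kernel D t y <= K + eps.
  move=> r'0 r'k y yr.
  have : box x rk y by move=> i; have := yr i => /andP[? ?]; apply/andP; split; lra.
  move=> /contK; rewrite ler_distl => /andP[? ?]; rewrite ge_max.
  by rewrite -andbA; apply/and3P; split=> //; rewrite mulr_ge0 ?powR_ge0 ?expR_ge0.
have hi0 : 0 < r * (1 + th) by rewrite mulr_gt0//; lra.
have lo0 : 0 < r * (1 - th) by rewrite mulr_gt0//; lra.
have hik : r * (1 + th) <= rk by nra.
have lok : r * (1 - th) <= rk by nra.
have hir : r < r * (1 + th) by nra.
have lor : r * (1 - th) < r by nra.
have max0 : 0 <= Num.max 0 (K - eps) by rewrite le_max lexx.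
have e0 : 0 < eps * (2 * r) ^+ d by rewrite mulr_gt0.
have hi_mass := near_gauss_mass hi0 max0 e0 (bnd _ hi0 hik).
have lo_mass := near_gauss_mass lo0 max0 e0 (bnd _ lo0 lok).
have hi_sum := near_mass (ltW r0) hir.
have lo_sum := near_mass (ltW lo0) lor.
have /cvgrPdist_le/(_ _ eps0) vol := hd r0.
near=> n.
have sn0 : 0 < sq n by near: n; exact: near_sqrt_gt0.
have n0 : 0 < n%:R :> R by rewrite -sqrtr_gt0.
have S0 : 0 < sq n ^+ d by rewrite exprn_gt0.
have Vg : vertex G (g n) by near: n; exact: near_gpoint_vertex.
have upper : forall k z, vertex G z -> t / 2 * n%:R <= k%:R ->
    p k z * sq n ^+ d <= B by near: n; exact: heat_kernel_upper.
have oscn : forall z, Lam ro n z -> `|q n z - q n (g n)| * sq n ^+ d <= eps by near: n.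
have /andP[_ hm] : Num.max 0 (K - eps) * (2 * (r * (1 + th))) ^+ d - eps * (2 * r) ^+ d <=
  mass (r * (1 + th)) n <= (K + eps) * (2 * (r * (1 + th))) ^+ d + eps * (2 * r) ^+ d
  by near: n.
have /andP[lm _] : Num.max 0 (K - eps) * (2 * (r * (1 - th))) ^+ d - eps * (2 * r) ^+ d <=
  mass (r * (1 - th)) n <= (K + eps) * (2 * (r * (1 - th))) ^+ d + eps * (2 * r) ^+ d
  by near: n.
have [hs _] : \sum_(z \in Lam r n) cond_vertex G mu z * q n z <= mass (r * (1 + th)) n /\
  mass r n <= \sum_(z \in Lam (r * (1 + th)) n) cond_vertex G mu z * q n z by near: n.
have [_ ls] : \sum_(z \in Lam (r * (1 - th)) n) cond_vertex G mu z * q n z <= mass r n /\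
  mass (r * (1 - th)) n <= \sum_(z \in Lam r n) cond_vertex G mu z * q n z by near: n.
have : `|aG - cond_measure G mu (Lam r n) / (2 * sq n * r) ^+ d| <= eps by near: n.
pose v := cond_measure G mu (Lam r n) / (2 * sq n * r) ^+ d.
have vE : cond_measure G mu (Lam r n) = v * (2 * r) ^+ d * sq n ^+ d.
  rewrite -mulrA -exprMn /v (mulrAC 2 r) mulfVK//.
  by rewrite expf_neq0// gt_eqF// !mulr_gt0.
rewrite -/v ler_distlC => /andP[v1 v2].
have [Q0 QB] : 0 <= q n (g n) * sq n ^+ d /\ q n (g n) * sq n ^+ d <= B.
  have tn1 : t * n%:R < (Num.truncn (n%:R * t)).+1%:R by rewrite mulrC truncnS_gt.
  have bigt : 2 / t <= n%:R by near: n; exact: near_natr.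
  have tn2 : 2 <= t * n%:R by move: bigt; rewrite ler_pdivrMr// [_ * t]mulrC.
  move: tn1; rewrite /avg /=; move: (Num.truncn _) => k kn.
  have k1 : k.+1%:R = k%:R + 1 :> R by rewrite natr1.
  have pn j := heat_kernel_ge0 G_infinite G_connected mu_cond P X 0 j Vg.
  have u1 := upper k.+1 (g n) Vg ltac:(lra).
  have u0 := upper k (g n) Vg ltac:(lra).
  rewrite mulrAC mulrDl; split.
    by rewrite divr_ge0// addr_ge0// mulr_ge0// ltW.
  by lra.
have finL : finite_set (Lam r n) by exact: finite_box_vertices.
have sumb : (q n (g n) * sq n ^+ d - eps) * (v * (2 * r) ^+ d) <=
      \sum_(z \in Lam r n) cond_vertex G mu z * q n z /\
    \sum_(z \in Lam r n) cond_vertex G mu z * q n z <=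
      (q n (g n) * sq n ^+ d + eps) * (v * (2 * r) ^+ d).
  have vS : v * (2 * r) ^+ d = cond_measure G mu (Lam r n) / sq n ^+ d.
    by rewrite vE mulfK// gt_eqF.
  have qz z : z \in fset_set (Lam r n) -> 0 < cond_vertex G mu z /\
      (q n (g n) * sq n ^+ d - eps) / sq n ^+ d <= q n z <=
      (q n (g n) * sq n ^+ d + eps) / sq n ^+ d.
    rewrite in_fset_set// => /set_mem zr; split.
      by apply: (cond_vertex_gt0 G_infinite G_connected mu_cond); have [] := zr.
    have := oscn z (scaled_box_vertices_sub rro zr).
    rewrite -ler_pdivlMr// ler_distl mulrBl mulrDl mulfK ?gt_eqF//.
  have cE a : a * (v * (2 * r) ^+ d) =
      \sum_(z <- fset_set (Lam r n)) cond_vertex G mu z * (a / sq n ^+ d).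
    rewrite vS -mulr_suml -fsbig_finite// -/(cond_measure _ _ _).
    by rewrite mulrCA.
  rewrite !cE fsbig_finite//; split; rewrite big_seq [leRHS]big_seq.
    by apply: ler_sum => z /qz[m0 /andP[z1 z2]]; rewrite ler_pM2l.
  by apply: ler_sum => z /qz[m0 /andP[z1 z2]]; rewrite ler_pM2l.
have [s1 s2] := sumb.
move: (le_trans (le_trans s1 hs) hm) (le_trans (le_trans lm ls) s2).
have powE c : (2 * (r * c)) ^+ d = (2 * r) ^+ d * c ^+ d by rewrite mulrA exprMn.
rewrite !powE => up lo.
have Kmax : K - eps <= Num.max 0 (K - eps) by rewrite le_max lexx orbT.
exact: (limit_from_bounds rd0 K0 aG0 eps01 Q0 QB v1 v2 thhi thlo Kmax max0 up lo).
Unshelve. all: by end_near. Qed.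

(** [heat_kernel_hat] is twice [q], and the factor [aG] of [near_limit] is divided out. *)
Lemma heat_kernel_local_limit :
  (fun n => n%:R `^ (d%:R / 2) *
            heat_kernel_hat G mu P X (n%:R * t) 0 (g n)) @ \oo -->
  2 * aG^-1 * gauss_kernel D t x.
Proof.
have aG0 := aG_gt0.
have [C C0 lim] := near_limit.
have cv : (fun n => q n (g n) * sq n ^+ d * aG) @ \oo --> gauss_kernel D t x.
  apply/cvgrPdist_le => e e0; pose eps := Num.min 1 (e / C).
  have eps01 : 0 < eps <= 1.
    by rewrite lt_min ltr01 divr_gt0// ge_min lexx.
  apply: filterS (lim _ eps01) => n /le_trans; apply.
  by rewrite mulrC -ler_pdivlMr// ge_min lexx orbT.
have -> : (fun n => n%:R `^ (d%:R / 2) * heat_kernel_hat G mu P X (n%:R * t) 0 (g n)) =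
    (fun n => 2 * aG^-1 * (q n (g n) * sq n ^+ d * aG)).
  apply/funext => n; rewrite natr_powR_half /heat_kernel_hat /avg.
  by field; rewrite gt_eqF.
by apply: cvgMr; exact: cv.
Qed.

End local_limit.

Theorem theorem4p2 (R : realType) (d : nat) (d_ge2 : (2 <= d)%N)
  (G : lattice_subgraph d)
  (G_infinite : infinite_set (vertex G)) (G_connected : connected_graph G)
  (G0 : vertex G 0)
  (mu : 'rV[int]_d -> 'rV[int]_d -> R) (CM CU : R)
  (mu_cond : conductances G mu CM) (mu_volume : volume_bound G mu CU)
  (disp : measure_display) (Omega : measurableType disp)
  (P : 'rV[int]_d -> probability Omega R) (X : nat -> Omega -> 'rV[int]_d)
  (X_chain : markov_chain G mu P X)
  (tie : rel 'rV[int]_d)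
  (tie_refl : reflexive tie) (tie_anti : antisymmetric tie)
  (tie_trans : transitive tie) (tie_total : total tie)
  (x : 'rV[R]_d) (t : R) (t_gt0 : 0 < t)
  (delta D CH C1 C2 C3 aG : R)
  (delta_gt0 : 0 < delta) (D_gt0 : 0 < D) (CH_gt0 : 0 < CH)
  (C1_gt0 : 0 < C1) (C2_gt0 : 0 < C2) (C3_gt0 : 0 < C3) (aG_gt0 : 0 < aG)
  (s : 'rV[int]_d -> R)
  (ha : forall (u : R) (y : 'rV[R]_d) (r : R), 0 < u -> 0 < r ->
    (fun n => P 0 [set w | box y r (rescaled_chain X n u w)]) @ \oo -->
    lebesgue_integral_Rd (box y r) (gauss_kernel D u))
  (hb : forall (y : 'rV[int]_d) (k : nat), vertex G y -> C3 <= k%:R ->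
    heat_kernel G mu P X k 0 y <= C2 * k%:R `^ (- (d%:R / 2)))
  (hc : forall (y : 'rV[int]_d) (r : R), vertex G y -> s y <= r ->
    PHI G mu CH y r (r ^+ 2))
  (hd : forall r : R, 0 < r ->
    (fun n => cond_measure G mu (scaled_box_vertices G n x r) /
              (2 * Num.sqrt n%:R * r) ^+ d) @ \oo --> aG)
  (he : forall r : R, 0 < r -> exists n0 : nat, forall n, (n0 <= n)%N ->
    forall x' y' : 'rV[int]_d,
      scaled_box_vertices G n x r x' -> scaled_box_vertices G n x r y' ->
      `|to_real x' - to_real y'| <= (gdist G x' y')%:R :> R /\
      (gdist G x' y')%:R <=
        Num.max (C1 * `|to_real x' - to_real y'|) (n%:R `^ (1 / 2 - delta)))
  (hf : (fun n => (Num.sqrt n%:R)^-1 * s (gpoint G tie n x)) @ \oo --> 0) :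
  (fun n => n%:R `^ (d%:R / 2) *
            heat_kernel_hat G mu P X (n%:R * t) 0 (gpoint G tie n x)) @ \oo -->
  2 * aG^-1 * gauss_kernel D t x.
Proof.
exact: (heat_kernel_local_limit G_infinite G_connected G0 mu_cond X_chain
  tie_trans tie_total t_gt0 delta_gt0 CH_gt0 C1_gt0 C2_gt0 aG_gt0 hb hc hd he hf ha).
Qed.
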